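(* Let $\alpha\in\mathbb R$ and let $\lambda\in\operatorname{Dens}_+(M)$ be a fixed background density. The Levi-Civita connection of the $\alpha$-Fisher--Rao metric $G^\alpha$ on $\operatorname{Dens}_+(M)$ is given by $$\nabla_a b = Db.a-\frac{1+\alpha}{2}\,\frac{a}{\mu}\frac{b}{\mu}\,\mu ,$$ which coincides with the Amari--Čencov $\alpha$-connection $\nabla^{(\alpha)}$ on $\operatorname{Dens}_+(M)$.
   Context: $M$ is a closed, oriented, $n$-dimensional smooth manifold. $\Omega^n(M)$ is the Fr\'echet space of smooth $n$-forms on $M$, and $\operatorname{Dens}_+(M)=\{\mu\in\Omega^n(M):\mu>0\}$ is the space of smooth positive densities, an open subset of $\Omega^n(M)$, so that $T_\mu\operatorname{Dens}_+(M)=\Omega^n(M)$. For $a\in\Omega^n(M)$ and $\mu\in\operatorname{Dens}_+(M)$, $\frac{a}{\mu}\in C^\infty(M)$ denotes the Radon--Nikodym derivative. For vector fields $a,b$ on $\operatorname{Dens}_+(M)$, $Db.a|_\mu=D_\mu b(a_\mu)$ is the directional derivative of $b$ in the direction $a_\mu$. The $\alpha$-Fisher--Rao metric (with background density $\lambda$) is $$G^\alpha_\mu(a,b)=\int_M\left(\frac{\mu}{\lambda}\right)^{-\alpha-1}\frac{a}{\lambda}\frac{b}{\lambda}\,\lambda,\qquad a,b\in T_\mu\operatorname{Dens}_+(M).$$ The Amari--Čencov $\alpha$-connection on $\operatorname{Dens}_+(M)$ is $\nabla^{(\alpha)}_a b=Db.a-\frac{1+\alpha}{2}\frac{a}{\mu}b$.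 The Levi-Civita connection of a (weak) Riemannian metric on a Fr\'echet manifold is the torsion-free affine connection compatible with the metric. *)

(* Defs.v *)
From HB Require Import structures.
From mathcomp Require Import all_boot all_order all_algebra finmap.
From mathcomp Require Import all_classical all_reals all_analysis.

Set Implicit Arguments.
Unset Strict Implicit.
Unset Printing Implicit Defensive.

Import Order.TTheory GRing.Theory Num.Theory.
Import numFieldNormedType.Exports.

Local Open Scope classical_set_scope.
Local Open Scope ring_scope.

Section SmoothFunctions.
Context {R : realType} {n : nat}.
Implicit Types (U : set 'rV[R]_n) (f g : 'rV[R]_n -> R^o).

Definition unit_row (i : 'I_n) : 'rV[R]_n := delta_mx ord0 i.

(* [partials [:: i1; ...; ik] f] is d_{i1} ... d_{ik} f *)
Definition partials (s : seq 'I_n) f : 'rV[R]_n -> R^o :=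
  foldr (fun i g => 'D_(unit_row i) g) f s.

(* The values of [partials s f] on an open set depend only on f there. *)
Definition smooth_fun U f := forall (s : seq 'I_n) (x : 'rV[R]_n), U x ->
  {for x, continuous (partials s f)} /\
  forall i, derivable (partials s f) x (unit_row i).

Lemma partials_lin U f g (a : R) s : open U ->
  smooth_fun U f -> smooth_fun U g ->
  forall x, U x ->
    partials s (a *: f + g) x = a *: partials s f x + partials s g x.
Proof.
move=> oU sf sg; elim: s => [//|i s IHs] x Ux /=.
have [_ /(_ i) df] := sf s x Ux; have [_ /(_ i) dg] := sg s x Ux.
rewrite (@near_eq_derive _ _ _ _ (a *: partials s f + partials s g));
  last first.
  by apply: (filterS IHs); exact: open_nbhs_nbhs.
rewrite deriveD//; last exact: derivableZ.
by rewrite deriveZ.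
Qed.

Lemma smooth_fun_lin U f g (a : R) : open U ->
  smooth_fun U f -> smooth_fun U g -> smooth_fun U (a *: f + g).
Proof.
move=> oU sf sg s x Ux.
have E : \near x,
    (a *: partials s f + partials s g) x = partials s (a *: f + g) x.
  apply: (@filterS _ _ _ U); last exact: open_nbhs_nbhs.
  by move=> y Uy; rewrite (partials_lin a s oU sf sg Uy).
have [cf df] := sf s x Ux; have [cg dg] := sg s x Ux; split.
  have cfg : {for x, continuous (a *: partials s f + partials s g)}.
    apply: (@cvgD R R^o 'rV[R]_n (nbhs x) _ (a *: partials s f) (partials s g));
      last exact: cg.
    exact: (@cvgZl_tmp R R^o 'rV[R]_n (nbhs x) _ a (partials s f) _ cf).
  rewrite /prop_for /continuous_at -(nbhs_singleton E).
  exact: (cvg_trans (@near_eq_cvg _ R^o (nbhs x) _ _ _ E) cfg).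
move=> i; apply: (near_eq_derivable E).
by apply: derivableD => //; exact: derivableZ.
Qed.

Lemma partials0 s : partials s (0 : 'rV[R]_n -> R^o) = 0.
Proof. by elim: s => //= i s ->; apply/funext => x; exact: derive_cst. Qed.

Lemma smooth_fun0 U : smooth_fun U 0.
Proof.
move=> s x Ux; rewrite partials0; split; first exact: cst_continuous.
by move=> i; exact: derivable_cst.
Qed.

End SmoothFunctions.

Section DirectionalDerivatives.
Context {R : realType}.

(* [E * F] carries the product topology and the componentwise operations. *)
HB.instance Definition _ (E F : preTopologicalLmodType R) :=
  Topological.on (E * F)%type.

Definition has_dderive {E F : preTopologicalLmodType R} (f : E -> F)
    (x v : E) (l : F) : Prop :=
  h^-1 *: (f (x + h *: v) - f x) @[h --> (0 : R)^'] --> l.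

(* The directional derivative Df(x)v, with default value 0. *)
Definition dderive {E F : preTopologicalLmodType R} (f : E -> F)
    (x v : E) : F :=
  xget 0 [set l | has_dderive f x v l].

(* C^k maps on an open set U in the sense of Michal-Bastiani (and Hamilton):
   f is C^(k+1) if Df : U x E -> F exists everywhere and is C^k. *)
Fixpoint smooth_upto (k : nat) {E F : preTopologicalLmodType R}
    (U : set E) (f : E -> F) : Prop :=
  (forall x, U x -> {for x, continuous f}) /\
  match k with
  | 0 => True
  | k'.+1 =>
      (forall x v, U x -> exists l, has_dderive f x v l) /\
      smooth_upto k' (U `*` [set: E]) (fun p : E * E => dderive f p.1 p.2)
  end.

Definition smooth_on {E F : preTopologicalLmodType R} (U : set E)
    (f : E -> F) : Prop := forall k, smooth_upto k U f.

End DirectionalDerivatives.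

Section EuclideanIntegral.
Context {R : realType}.

(* Iterated Lebesgue integral over R^n. *)
Fixpoint int_rV (n : nat) : ('rV[R]_n -> R) -> R :=
  match n with
  | 0 => fun f => f 0
  | m.+1 => fun f =>
      \int[@lebesgue_measure R]_t
        int_rV (fun y : 'rV[R]_m => f (row_mx (t%:M : 'rV[R]_1) y))
  end.

End EuclideanIntegral.

Record chart (R : realType) (n : nat) (M : topologicalType) := Chart {
  cdom : set M;
  cmap : M -> 'rV[R]_n;
  cinv : 'rV[R]_n -> M;
  open_cdom : open cdom;
  open_cimg : open (cmap @` cdom);
  cmapK : forall x, cdom x -> cinv (cmap x) = x;
  cmap_continuous : forall x, cdom x -> {for x, continuous cmap};
  cinv_continuous : forall x, cdom x -> {for cmap x, continuous cinv}
}.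

(* An oriented atlas determines the smooth structure and the orientation. *)
Record closed_oriented_manifold (R : realType) (n : nat) := ClosedManifold {
  carrier :> topologicalType;
  mfd_hausdorff : hausdorff_space carrier;
  mfd_second_countable : @second_countable carrier;
  mfd_compact : compact [set: carrier];
  chart_ix : Type;
  mfd_chart : chart_ix -> chart R n carrier;
  mfd_cover : forall x, exists i, cdom (mfd_chart i) x;
  transition := fun i j (y : 'rV[R]_n) =>
    cmap (mfd_chart j) (cinv (mfd_chart i) y);
  transition_smooth : forall i j (k : 'I_n),
    smooth_fun (cmap (mfd_chart i) @`
                 (cdom (mfd_chart i) `&` cdom (mfd_chart j)))
               (fun y => transition i j y ord0 k);
  transition_oriented : forall i j x,
    cdom (mfd_chart i) x -> cdom (mfd_chart j) x ->
    0 < \det ('J (transition i j) (cmap (mfd_chart i) x))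
}.

Arguments mfd_chart {R n} c i.
Arguments transition {R n} c i j y.

Section Forms.
Context {R : realType} {n : nat} (M : closed_oriented_manifold R n).
Local Notation ix := (chart_ix M).

Definition dom (i : ix) : set M := cdom (mfd_chart M i).
Definition phi (i : ix) : M -> 'rV[R]_n := cmap (mfd_chart M i).
Definition psi (i : ix) : 'rV[R]_n -> M := cinv (mfd_chart M i).
Definition img (i : ix) : set 'rV[R]_n := phi i @` dom i.

(* An n-form is given by its coefficients: [w i x] is the coefficient at x of
   dy^1 /\ ... /\ dy^n, for y the coordinates of the chart i around x, and is
   0 by convention outside [dom i], so that equal forms have equal
   coefficients. A change of coordinates multiplies the coefficient by the
   determinant of the Jacobian. *)
Definition is_form (w : ix -> M -> R) : Prop :=
  [/\ forall i x, ~ dom i x -> w i x = 0,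
      forall i j x, dom i x -> dom j x ->
        w i x = w j x * \det ('J (transition M i j) (phi i x)) &
      forall i, smooth_fun (img i) (fun y => w i (psi i y))].

Definition form_pred : {pred ix -> M -> R} := fun w => `[< is_form w >].

Lemma form_submod_closed : GRing.submod_closed form_pred.
Proof.
split=> [|a u v /asboolP[u0 uJ us] /asboolP[v0 vJ vs]]; apply/asboolP;
  split=> //.
- by move=> i j x _ _; rewrite mul0r.
- by move=> i; exact: smooth_fun0.
- move=> i x nx; change (a * u i x + v i x = 0).
  by rewrite u0// v0// mulr0 addr0.
- move=> i j x xi xj.
  change (a * u i x + v i x = (a * u j x + v j x) *
    \det ('J (transition M i j) (phi i x))).
  by rewrite (uJ i j)// (vJ i j)// mulrDl mulrA.
- move=> i.
  change (smooth_fun (img i)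
    (a *: ((fun y => u i (psi i y)) : 'rV[R]_n -> R^o) +
     ((fun y => v i (psi i y)) : 'rV[R]_n -> R^o))).
  by apply: smooth_fun_lin; [exact: open_cimg|exact: us|exact: vs].
Qed.

HB.instance Definition _ :=
  GRing.isSubmodClosed.Build R (ix -> M -> R) form_pred form_submod_closed.

Record nform := Form { coef :> ix -> M -> R; _ : coef \in form_pred }.

HB.instance Definition _ := [isSub for coef].
HB.instance Definition _ := [Choice of nform by <:].
HB.instance Definition _ := [SubChoice_isSubLmodule of nform by <:].

(* The C^oo topology: uniform convergence, on the compact subsets of each
   chart, of the coefficients and all their partial derivatives. *)
Definition jets (w : nform) :
    prod_topology (fun p : ix * seq 'I_n =>
      {family compactly_in (img p.1), 'rV[R]_n -> R}) :=
  fun p => partials p.2 (fun y => w p.1 (psi p.1 y)).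

HB.instance Definition _ := Topological.copy nform (initial_topology jets).
HB.instance Definition _ := PreTopologicalLmodule.on nform.

Definition dens_pos : set nform := [set mu | forall i x, dom i x -> 0 < mu i x].

Definition chart_at (x : M) : ix := sval (cid (mfd_cover x)).

(* The quotient does not depend on the chart. *)
Definition radon_nikodym (a mu : nform) (x : M) : R :=
  a (chart_at x) x / mu (chart_at x) x.


(* Continuity of the functions is all that is needed to define integrals. *)
Record partition_of_unity := PartitionOfUnity {
  pou_size : nat;
  pou_ix : 'I_pou_size -> ix;
  pou_fun : 'I_pou_size -> M -> R;
  pou_continuous : forall k, continuous (pou_fun k);
  pou_ge0 : forall k x, 0 <= pou_fun k x;
  pou_support : forall k,
    closure [set x | pou_fun k x != 0] `<=` dom (pou_ix k);
  pou_sum : forall x, \sum_(k < pou_size) pou_fun k x = 1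
}.

Lemma bump_exists (x : M) : exists ig : ix * (M -> R),
  [/\ continuous ig.2, forall y, 0 <= ig.2 y, 0 < ig.2 x &
      closure [set y | ig.2 y != 0] `<=` dom ig.1].
Proof.
have [i xi] := mfd_cover x.
have nM : normal_space M.
  exact: compact_normal (@mfd_hausdorff _ _ M) (@mfd_compact _ _ M).
have clx : closed [set x].
  by apply: accessible_closed_set1; apply: hausdorff_accessible;
    exact: mfd_hausdorff.
have : set_nbhs [set x] (dom i).
  by move=> _ ->; apply: open_nbhs_nbhs; split => //; exact: open_cdom.
move=> /(nM _ clx) [B Bx Bi].
have oC : open B^° by exact: open_interior.
have xC : [set x] `<=` B^° by move=> y xy; exact: Bx.
have CB : B^° `<=` B by exact: interior_subset.
set C := B^° in oC xC CB.
have us : @uniform_separator M (~` C) [set x].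
  apply: ((@normal_separatorP R M).1 nM) => //; first exact: open_closedC.
  by rewrite -subset0 => y [/= nC yx]; apply: nC; rewrite yx; exact: xC.
have [f [cf f01 f0 f1]] := (@uniform_separatorP M R _ _).1 us.
exists (i, f); split => //=.
- move=> y; have : f y \in `[0, 1]%R by apply: f01; exists y.
  by rewrite in_itv => /andP[].
- suff -> : f x = 1 by [].
  by apply: f1; exists x.
- apply: subset_trans Bi; apply: closureS => y /= /eqP fy; apply: CB.
  by apply: contrapT => nCy; apply: fy; apply: f0; exists y.
Qed.

Lemma partition_of_unity_exists : exists P : partition_of_unity, True.
Proof.
have [[x0 _]|M0] := pselect (exists x : M, True); last first.
  have noM (x : M) : False by apply: M0; exists x.
  by exists (@PartitionOfUnity 0
    (fun k => match notF (ltn_ord k) with end) (fun _ _ => 0)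
    (fun _ x => match noM x with end) (fun _ _ => lexx _)
    (fun _ x => match noM x with end) (fun x => match noM x with end)).
have [ig igP] := choice bump_exists.
have : @cover_compact M [set: M].
  pose pM : ptopologicalType :=
    HB.pack (Topological.sort M) (isPointed.Build (Topological.sort M) x0).
  change (@cover_compact pM [set: pM]).
  by rewrite -(@compact_cover pM); exact: (@mfd_compact _ _ M).
move=> /(_ M [set: M] (fun x => [set y | 0 < (ig x).2 y])).
case=> [x _|x _|D _ Dcov].
- have [cg _ _ _] := igP x.
  exact: (open_comp (fun y _ => cg y) (@open_gt _ 0)).
- by exists x => //=; have [] := igP x.
set s := enum_fset D.
pose S (y : M) := \sum_(k < size s) (ig (tnth (in_tuple s) k)).2 y.
have S0 y : 0 < S y.
  have [x /= xD gx] := Dcov y I.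
  have xs : (index x s < size s)%N by rewrite index_mem.
  rewrite /S (bigD1 (Ordinal xs))//= ltr_pwDl//.
    by rewrite (tnth_nth x)/= nth_index.
  by apply: sumr_ge0 => k _; have [_ + _ _] := igP (tnth (in_tuple s) k).
have cS : continuous S.
  have := @continuous_big R 'I_(size s) +%R 0 xpredT (@add_continuous R) M
    (index_enum 'I_(size s)) (fun k => (ig (tnth (in_tuple s) k)).2).
  by apply => k _; have [+ _ _ _] := igP (tnth (in_tuple s) k).
unshelve eexists (@PartitionOfUnity (size s)
  (fun k => (ig (tnth (in_tuple s) k)).1)
  (fun k y => (ig (tnth (in_tuple s) k)).2 y / S y) _ _ _ _) => //=.
- move=> k y; have [cg _ _ _] := igP (tnth (in_tuple s) k).
  apply: continuousM; first exact: cg.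
  by apply: continuousV; [exact: lt0r_neq0|exact: cS].
- move=> k y; apply: divr_ge0; last exact/ltW.
  by have [_ + _ _] := igP (tnth (in_tuple s) k).
- move=> k; have [_ _ _ supp] := igP (tnth (in_tuple s) k).
  refine (subset_trans _ supp); apply: closureS => y /=; apply: contra_neq.
  by move=> ->; rewrite mul0r.
- by move=> y; rewrite -mulr_suml -/(S y) divff// lt0r_neq0.
Qed.

Definition pou_integral (P : partition_of_unity) (w : ix -> M -> R) : R :=
  \sum_(k < pou_size P)
    int_rV (fun y => \1_(img (pou_ix k)) y *
      (pou_fun k (psi (pou_ix k) y) * w (pou_ix k) (psi (pou_ix k) y))).

(* The integral over M of the n-form with coefficients w; as usual it is
   computed with some partition of unity, the choice being immaterial. *)
Definition mfd_integral (w : ix -> M -> R) : R :=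
  pou_integral (sval (cid partition_of_unity_exists)) w.

Definition fisher_rao (alpha : R) (lambda mu a b : nform) : R :=
  mfd_integral (fun i x =>
    radon_nikodym mu lambda x `^ (- alpha - 1) *
    radon_nikodym a lambda x * radon_nikodym b lambda x * lambda i x).

End Forms.

Arguments dens_pos {R n} M.

Section Connections.
Context {R : realType} {n : nat} (M : closed_oriented_manifold R n).
Local Notation field := (nform M -> nform M).
Implicit Types (a b c : field) (f : nform M -> R^o).

(* Vector fields on the open set [dens_pos M] of [nform M] are represented by
   total maps, whose values outside [dens_pos M] are irrelevant. *)
Definition vector_field a : Prop := smooth_on (dens_pos M) a.

Record affine_connection
    (nabla : field -> field -> field) :
    Prop := AffineConnection {
  conn_smooth : forall a b, vector_field a -> vector_field b ->
    vector_field (nabla a b);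
  conn_ext : forall a a' b b',
    vector_field a -> vector_field a' -> vector_field b -> vector_field b' ->
    (forall mu, dens_pos M mu -> a mu = a' mu) ->
    (forall mu, dens_pos M mu -> b mu = b' mu) ->
    forall mu, dens_pos M mu -> nabla a b mu = nabla a' b' mu;
  conn_addl : forall a a' b,
    vector_field a -> vector_field a' -> vector_field b ->
    forall mu, dens_pos M mu ->
      nabla (fun nu => a nu + a' nu) b mu = nabla a b mu + nabla a' b mu;
  conn_addr : forall a b b',
    vector_field a -> vector_field b -> vector_field b' ->
    forall mu, dens_pos M mu ->
      nabla a (fun nu => b nu + b' nu) mu = nabla a b mu + nabla a b' mu;
  conn_scalel : forall f a b,
    smooth_on (dens_pos M) f -> vector_field a -> vector_field b ->
    forall mu, dens_pos M mu ->
      nabla (fun nu => f nu *: a nu) b mu = f mu *: nabla a b mu;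
  conn_leibniz : forall f a b,
    smooth_on (dens_pos M) f -> vector_field a -> vector_field b ->
    forall mu, dens_pos M mu ->
      nabla a (fun nu => f nu *: b nu) mu =
        dderive f mu (a mu) *: b mu + f mu *: nabla a b mu
}.

Definition torsion_free
    (nabla : field -> field -> field) :
    Prop :=
  forall a b, vector_field a -> vector_field b -> forall mu, dens_pos M mu ->
    nabla a b mu - nabla b a mu = dderive b mu (a mu) - dderive a mu (b mu).

Definition metric_compatible (g : nform M -> nform M -> nform M -> R)
    (nabla : field -> field -> field) :
    Prop :=
  forall a b c, vector_field a -> vector_field b -> vector_field c ->
  forall mu, dens_pos M mu ->
    has_dderive (fun nu => g nu (b nu) (c nu) : R^o) mu (a mu)
      (g mu (nabla a b mu) (c mu) + g mu (b mu) (nabla a c mu)).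

Definition levi_civita (g : nform M -> nform M -> nform M -> R)
    (nabla : field -> field -> field) :
    Prop :=
  [/\ affine_connection nabla, torsion_free nabla & metric_compatible g nabla].

(* The coefficients of Db.a - (1 + alpha) / 2 (a / mu) b at mu. *)
Definition amari_cencov (alpha : R) a b (mu : nform M) : chart_ix M -> M -> R :=
  fun i x => dderive b mu (a mu) i x -
    (1 + alpha) / 2 * (radon_nikodym (a mu) mu x * b mu i x).

End Connections.

(* Main.v *)
Require Import Defs.
From mathcomp Require Import all_boot all_order all_algebra.
From mathcomp Require Import all_classical all_reals all_analysis.
From mathcomp Require Import ring lra.
Import Order.TTheory GRing.Theory Num.Theory.
Import numFieldNormedType.Exports.
Local Open Scope classical_set_scope.
Local Open Scope ring_scope.

(** The connection [alpha_conn a b = Db.a - (1 + alpha) / 2 (a b / mu)] is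
    torsion-free because its correction term is symmetric in [a] and [b]. It is
    compatible with the metric because, pointwise and with [p = - alpha - 1],
    the derivative of [(mu / lambda)^p (b / lambda) (c / lambda) lambda] along
    [a] is the sum of the two terms in which [b], resp. [c], is differentiated
    and of [p (a / mu)] times the integrand; the last one is what the
    corrections of [b] and of [c], each with the coefficient [p / 2], add up to.
    Uniqueness is Koszul's argument: the difference [D] of two Levi-Civita
    connections is symmetric and [g (D(a, b)) c] is skew in [b, c], so it
    vanishes; applied to the constant field [c = D(a, b)] this gives [D = 0],
    since the metric is definite ([levi_civita_unique]).

    What takes work is the analysis on the Frechet space of forms, which has to
    be carried out on iterated products of this space as well, since the k-th
    derivative of a map on [E] is a map on the product of [2 ^ k] copies of [E].
    All these spaces have in common that a filter converges exactly when the
    values of suitable linear functionals, depending on a parameter, converge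
    jointly in the point and in the parameter ([evaluations]). For forms the
    functionals are the partial derivatives of the coefficients, and the
    property expresses that locally uniform convergence to a continuous function
    is the same as continuous convergence ([form_cvgE]). The real mean value
    theorem, applied to each functional, then yields that difference quotients
    converge even when the base point and the direction move
    ([strong_derivative]); additivity of the derivative and the chain rule in
    all orders ([smooth_upto_comp]) follow.

    The smoothness of [alpha_conn a b] is reduced in this way to that of the map
    [(mu, a, b) |-> a b / mu]. It is continuous, by Leibniz rules for families
    of functions ([quot3_continuous]), and each of its difference quotients is
    a combination of values of the same map ([form_quot_incr]), so that all its
    derivatives are obtained by composing it with itself and with linear maps
    ([smooth_upto_quot3]).

    Differentiation under the integral sign and definiteness of the metric only
    involve integrals of continuous functions with compact support: on these the
    iterated integral is linear, continuous for uniform convergence, and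
    vanishes on a nonnegative function only if that function is zero. *)

Set Implicit Arguments.
Unset Strict Implicit.
Unset Printing Implicit Defensive.

(** * Topological vector spaces with jointly convergent functionals *)

Section Evaluations.
Context {R : realType}.

(** The functionals are indexed by the points of [ev_dom]; the filters [ev_nbhs]
    play the role of a topology on the indices. The last field is what makes the
    functionals control the topology: convergence in [E] is convergence of the
    values jointly in the vector and in the index. *)
Record evaluations (E : preTopologicalLmodType R) := Evaluations {
  ev_ix : Type;
  ev_dom : set ev_ix;
  ev_nbhs : ev_ix -> set_system ev_ix;
  ev : ev_ix -> E -> R;
  ev_filter : forall y, Filter (ev_nbhs y);
  ev_refl : forall y A, ev_nbhs y A -> A y;
  ev_nbhs_dom : forall y, ev_dom y -> ev_nbhs y ev_dom;
  ev_lin : forall y, ev_dom y -> forall a u v,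
    ev y (a *: u + v) = a * ev y u + ev y v;
  ev_inj : forall u v, (forall y, ev_dom y -> ev y u = ev y v) -> u = v;
  ev_cvgE : forall (G : set_system E) (w : E), Filter G ->
    G --> w <-> forall y, ev_dom y ->
      ev p.2 p.1 @[p --> filter_prod G (ev_nbhs y)] --> ev y w
}.
#[global] Existing Instance ev_filter.
Arguments ev_ix {E} e.
Arguments ev_dom {E} e _.
Arguments ev_nbhs {E} e y _.
Arguments ev {E} e y u.
Arguments ev_cvgE {E} e {G w} _.

Section OneSpace.
Context {E : preTopologicalLmodType R} (e : evaluations E).

Lemma evD y u v : ev_dom e y -> ev e y (u + v) = ev e y u + ev e y v.
Proof. by move=> Dy; have := ev_lin Dy 1 u v; rewrite scale1r mul1r. Qed.

Lemma ev0 y : ev_dom e y -> ev e y 0 = 0.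
Proof.
move=> Dy; have := evD 0 0 Dy; rewrite addr0 => E0.
by apply: (addrI (ev e y 0)); rewrite -E0 addr0.
Qed.

Lemma evZ y a u : ev_dom e y -> ev e y (a *: u) = a * ev e y u.
Proof. by move=> Dy; have := ev_lin Dy a u 0; rewrite ev0// !addr0. Qed.

Lemma evB y u v : ev_dom e y -> ev e y (u - v) = ev e y u - ev e y v.
Proof. by move=> Dy; rewrite evD// -scaleN1r evZ// mulN1r. Qed.

Lemma ev_cvgP {X : Type} (G : set_system X) {FG : Filter G} (u : X -> E)
    (w : E) :
  u @ G --> w <-> forall y, ev_dom e y ->
    ev e p.2 (u p.1) @[p --> filter_prod G (ev_nbhs e y)] --> ev e y w.
Proof.
rewrite (ev_cvgE e); split=> + y Dy => /(_ y Dy) H A /H.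
  case=> -[P Q] /= [GP NQ] PQ; exists (u @^-1` P, Q) => //= -[g z] /= [Pg Qz].
  exact: (PQ (u g, z)).
case=> -[P Q] /= [GP NQ] PQ; exists (u @` P, Q) => /=.
  by split=> //; apply: filterS GP => g Pg; exists g.
by move=> [v z] /= [[g Pg <-] Qz]; exact: (PQ (g, z)).
Qed.

Lemma ev_cvg {X : Type} (G : set_system X) {FG : Filter G} (u : X -> E)
    (w : E) y :
  ev_dom e y -> u @ G --> w -> ev e y (u g) @[g --> G] --> ev e y w.
Proof.
move=> Dy /ev_cvgP /(_ y Dy) H A /H [[P Q] /= [GP NQ] PQ].
apply: (@filterS _ G _ P) GP => g Pg.
exact: (PQ (g, y) (conj Pg (ev_refl NQ))).
Qed.

Lemma ev_cvg_unique {X : Type} (G : set_system X) {FG : ProperFilter G}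
  (u : X -> E) (w w' : E) : u @ G --> w -> u @ G --> w' -> w = w'.
Proof.
move=> uw uw'; apply: (ev_inj (e := e)) => y Dy.
exact: (cvg_unique _ (ev_cvg Dy uw) (ev_cvg Dy uw')).
Qed.

Lemma ev_cvg_lin {X : Type} (G : set_system X) {FG : Filter G}
    (c : X -> R) (u v : X -> E) (c0 : R) (u0 v0 : E) :
  c @ G --> c0 -> u @ G --> u0 -> v @ G --> v0 ->
  c g *: u g + v g @[g --> G] --> c0 *: u0 + v0.
Proof.
move=> cc /ev_cvgP cu /ev_cvgP cv; apply/ev_cvgP => y Dy.
rewrite ev_lin//.
apply: (@cvg_trans _ (c p.1 * ev e p.2 (u p.1) + ev e p.2 (v p.1)
    @[p --> filter_prod G (ev_nbhs e y)])).
  apply: near_eq_cvg; exists (setT, ev_dom e) => /=.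
    by split; [exact: filterT|exact: ev_nbhs_dom].
  by move=> [g z] /= [_ Dz]; rewrite ev_lin.
apply: cvgD; last exact: cv.
apply: cvgM; last exact: cu.
exact: (cvg_comp _ _ (@cvg_fst _ _ G (ev_nbhs e y) _) cc).
Qed.

Lemma ev_cvgD {X : Type} (G : set_system X) {FG : Filter G}
    (u v : X -> E) (u0 v0 : E) :
  u @ G --> u0 -> v @ G --> v0 -> u g + v g @[g --> G] --> u0 + v0.
Proof.
move=> cu cv; have := ev_cvg_lin (cvg_cst (1 : R)) cu cv.
rewrite scale1r; under eq_fun do rewrite scale1r; exact.
Qed.

Lemma ev_cvgZ {X : Type} (G : set_system X) {FG : Filter G}
    (c : X -> R) (u : X -> E) (c0 : R) (u0 : E) :
  c @ G --> c0 -> u @ G --> u0 -> c g *: u g @[g --> G] --> c0 *: u0.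
Proof.
move=> cc cu; have := ev_cvg_lin cc cu (cvg_cst (0 : E)).
rewrite addr0; under eq_fun do rewrite addr0; exact.
Qed.

Lemma ev_cvgB {X : Type} (G : set_system X) {FG : Filter G}
    (u v : X -> E) (u0 v0 : E) :
  u @ G --> u0 -> v @ G --> v0 -> u g - v g @[g --> G] --> u0 - v0.
Proof.
move=> cu cv; have := ev_cvg_lin (cvg_cst (-1 : R)) cv cu.
rewrite scaleN1r addrC; under eq_fun do rewrite scaleN1r addrC; exact.
Qed.

(** The parameter [t] is added to the filter as a further variable, ranging over
    the principal filter of the segment, so that the convergence is uniform in
    it; this is what a mean value theorem with an unknown [t] requires. *)
Lemma near_segment {X : Type} (G : set_system X) {FG : Filter G}
    (x v : X -> E) (h : X -> R) (x0 v0 : E) (W : set E) :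
  x @ G --> x0 -> v @ G --> v0 -> h @ G --> (0 : R) -> nbhs x0 W ->
  \forall g \near G, forall t, t \in `[0, 1]%R -> W (x g + t *: (h g *: v g)).
Proof.
move=> cx cv ch nW.
pose I := globally [set t : R | t \in `[0, 1]%R].
have FI : Filter I by exact: globally_filter.
have cth : p.2 * h p.1 @[p --> filter_prod G I] --> (0 : R).
  apply/cvgr0Pnorm_lt => r r0; move/cvgr0Pnorm_lt: ch => /(_ r r0) hr.
  exists ([set g | `|h g| < r], [set t : R | t \in `[0, 1]%R]) => /=.
    by split=> //; move=> t.
  move=> [g t] /= [hg]; rewrite in_itv/= => /andP[t0 t1].
  by rewrite normrM (ger0_norm t0); apply: le_lt_trans hg; exact: ler_piMl.
have cfst : p.1 @[p --> filter_prod G I] --> G by exact: cvg_fst.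
have := ev_cvg_lin cth (cvg_comp _ _ cfst cv) (cvg_comp _ _ cfst cx).
rewrite scale0r add0r => /(_ _ W nW) [[P Q] /= [GP IQ] PQ].
apply: filterS GP => g Pg t t01; rewrite scalerA addrC.
exact: (PQ (g, t) (conj Pg (IQ _ t01))).
Qed.

End OneSpace.
Section Instances.

Definition ev_regular : evaluations (R^o : preTopologicalLmodType R).
Proof.
apply: (@Evaluations (R^o : preTopologicalLmodType R) unit setT
  (fun _ => globally [set tt]) (fun _ u => u) (fun=> globally_filter _)) => //.
- by move=> [] A; apply.
- by move=> u v /(_ tt I).
- move=> G w FG; split=> [Gw [] _|/(_ tt I) H A wA].
    by apply: cvg_trans Gw; exact: cvg_fst.
  have [[P Q] /= [GP NQ] PQ] := H A wA.
  by apply: filterS GP => v Pv; apply: (PQ (v, tt)); split=> //; exact: NQ.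
Defined.

Section Prod.
Context {E F : preTopologicalLmodType R}.
Variables (e : evaluations E) (f : evaluations F).

Definition prod_ev (y : ev_ix e + ev_ix f) (u : E * F) : R :=
  match y with inl y => ev e y u.1 | inr y => ev f y u.2 end.

Definition prod_dom : set (ev_ix e + ev_ix f) :=
  fun y => match y with inl y => ev_dom e y | inr y => ev_dom f y end.

Definition prod_ev_nbhs (y : ev_ix e + ev_ix f) :
    set_system (ev_ix e + ev_ix f) :=
  match y with
  | inl y => inl @ ev_nbhs e y
  | inr y => inr @ ev_nbhs f y
  end.

Lemma prod_ev_cvgE (G : set_system (E * F)) (w : E * F) : Filter G ->
  G --> w <-> forall y, prod_dom y ->
    prod_ev p.2 p.1 @[p --> filter_prod G (prod_ev_nbhs y)] --> prod_ev y w.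
Proof.
move=> FG; split=> [Gw|H].
  have G1 : fst @ G --> w.1.
    exact: (cvg_trans (cvg_app _ Gw) cvg_fst).
  have G2 : snd @ G --> w.2.
    exact: (cvg_trans (cvg_app _ Gw) cvg_snd).
  case=> y Dy A yA.
    have [[P Q] /= [GP NQ] PQ] := (ev_cvgP e _ _).1 G1 y Dy A yA.
    exists (P, inl @` Q) => /=.
      by split=> //; apply: filterS NQ => z Qz; exists z.
    by move=> [v z] /= [Pv [z' Qz <-]]; exact: (PQ (v, z')).
  have [[P Q] /= [GP NQ] PQ] := (ev_cvgP f _ _).1 G2 y Dy A yA.
  exists (P, inr @` Q) => /=.
    by split=> //; apply: filterS NQ => z Qz; exists z.
  by move=> [v z] /= [Pv [z' Qz <-]]; exact: (PQ (v, z')).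
have G1 : fst @ G --> w.1.
  apply/(ev_cvgP e) => y Dy A yA.
  have [[P Q] /= [GP NQ] PQ] := H (inl y) Dy A yA.
  exists (P, inl @^-1` Q) => //= -[v z] [Pv Qz]; exact: (PQ (v, inl z)).
have G2 : snd @ G --> w.2.
  apply/(ev_cvgP f) => y Dy A yA.
  have [[P Q] /= [GP NQ] PQ] := H (inr y) Dy A yA.
  exists (P, inr @^-1` Q) => //= -[v z] [Pv Qz]; exact: (PQ (v, inr z)).
move=> A [[P Q] /= [P1 Q2] PQ].
apply: (@filterS _ G _ ((fst @^-1` P) `&` (snd @^-1` Q))).
  by move=> [a b]; exact: PQ.
by apply: filterI; [exact: G1|exact: G2].
Qed.

(** The indices of the two factors are put side by side: a functional only looks
    at one component. *)
Definition ev_prod : evaluations ((E * F)%type : preTopologicalLmodType R).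
Proof.
apply: (@Evaluations ((E * F)%type : preTopologicalLmodType R) _
  prod_dom prod_ev_nbhs prod_ev).
- by case=> y /=; exact: fmap_filter.
- by case=> y A /= /ev_refl.
- by case=> y /= Dy; exact: ev_nbhs_dom.
- by case=> y /= Dy a u v; exact: ev_lin.
- move=> [u1 u2] [v1 v2] H; congr (_, _).
    by apply: (ev_inj (e := e)) => y Dy; exact: (H (inl y)).
  by apply: (ev_inj (e := f)) => y Dy; exact: (H (inr y)).
- exact: prod_ev_cvgE.
Defined.

End Prod.
End Instances.
End Evaluations.
Arguments ev_ix {R E} e.
Arguments ev_dom {R E} e _.
Arguments ev_nbhs {R E} e y _.
Arguments ev {R E} e y u.
Arguments ev_cvgE {R E} e {G w} _.

(** * Differential calculus in the sense of Michal and Bastiani *)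

Section Calculus.
Context {R : realType}.
Implicit Types (E F : preTopologicalLmodType R).

Lemma cvg_dnbhs0 {X : Type} (G : set_system X) {FG : Filter G} (h : X -> R) :
  h @ G --> (0 : R) -> (\forall g \near G, h g != 0) -> h @ G --> (0 : R)^'.
Proof.
move=> ch h0 A /ch hA; apply: (@filterS2 _ G _ _ _ (h @^-1` A) _ hA h0).
by move=> g; apply.
Qed.

Lemma has_dderive_dderive E F (f : E -> F) x v :
  (exists l, has_dderive f x v l) -> has_dderive f x v (dderive f x v).
Proof.
by move=> [l fl]; apply: (xgetPex 0 (P := has_dderive f x v)); exists l.
Qed.

Lemma dderive_eq E F (eF : evaluations F) (f : E -> F) x v l :
  has_dderive f x v l -> dderive f x v = l.
Proof.
move=> fl; apply: (ev_cvg_unique eF _ fl).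
exact: (@has_dderive_dderive _ _ f x v (ex_intro _ l fl)).
Qed.

Lemma has_dderive0 E F (eF : evaluations F) (f : E -> F) x :
  has_dderive f x 0 0.
Proof.
rewrite /has_dderive; under eq_fun do rewrite scaler0 addr0 subrr scaler0.
exact: cvg_cst.
Qed.

Lemma has_dderiveZ E F (eF : evaluations F) (f : E -> F) x v l (c : R) :
  has_dderive f x v l -> has_dderive f x (c *: v) (c *: l).
Proof.
move=> fl; have [->|c0] := eqVneq c 0.
  by rewrite !scale0r; exact: has_dderive0.
have hc : h * c @[h --> (0 : R)^'] --> (0 : R)^'.
  apply: cvg_dnbhs0; last first.
    by near=> h; rewrite mulf_neq0//; near: h; exact: nbhs_dnbhs_neq.
  rewrite -[X in _ --> X](mul0r c); apply: cvgMr_tmp; exact: nbhs_dnbhs.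
rewrite /has_dderive.
apply: cvg_trans (ev_cvgZ eF (cvg_cst c) (cvg_comp _ _ hc fl)).
apply: near_eq_cvg; near=> h => /=.
by rewrite !scalerA invfM mulrCA divff// mulr1.
Unshelve. all: by end_near. Qed.

(** A mean value theorem for vector-valued maps holds functional by functional,
    with an intermediate point that depends on the functional. *)
Lemma ev_mean_value E F (eF : evaluations F) (f : E -> F) x v (l : R -> F) y :
  ev_dom eF y ->
  (forall t, t \in `[0, 1]%R -> has_dderive f (x + t *: v) v (l t)) ->
  exists2 t, t \in `[0, 1]%R &
    ev eF y (f (x + v)) - ev eF y (f x) = ev eF y (l t).
Proof.
move=> Dy fl; pose phi t : R := ev eF y (f (x + t *: v)).
have dphi (t : R) : t \in `[0, 1]%R -> is_derive t 1 phi (ev eF y (l t)).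
  move=> t01.
  have H : h^-1 *: ((phi \o shift t) (h *: 1) - phi t) @[h --> 0^']
      --> ev eF y (l t).
    apply: cvg_trans (ev_cvg Dy (fl t t01)); apply: near_eq_cvg.
    near=> h => /=; rewrite evZ// evB// /phi /shift /=.
    congr (_ * (ev eF y (f _) - _)); rewrite -addrA -scalerDl.
    by congr (_ + _ *: _); rewrite addrC; congr (_ + _); exact/esym/mulr1.
  have D1 : derivable phi t 1 by apply/cvg_ex; exists (ev eF y (l t)).
  by apply: (DeriveDef D1); exact: cvg_lim.
have sub (t : R) : t \in `]0, 1[%R -> t \in `[0, 1]%R.
  by rewrite !in_itv/= => /andP[/ltW -> /ltW ->].
have [|t t01] := @MVT R phi (fun t => ev eF y (l t)) 0 1 ltr01
  (fun t t01 => dphi t (sub t t01)).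
  apply: derivable_within_continuous => t t01.
  by have [] := dphi t t01.
rewrite /phi scale1r scale0r addr0 subr0 mulr1 => E'.
by exists t => //; exact: sub.
Unshelve. all: by end_near. Qed.

(** For a functional close to a given one, the mean value theorem expresses the
    difference quotient as a value of the derivative at an intermediate point,
    which tends to [x0] uniformly by [near_segment]; joint convergence in the
    functional and the vector absorbs the dependence of that point on the
    functional. *)
Theorem strong_derivative E F (eE : evaluations E) (eF : evaluations F)
    (U : set E) (f : E -> F) {X : Type} (G : set_system X) {FG : Filter G}
    (x v : X -> E) (h : X -> R) (x0 v0 : E) :
  open U -> smooth_upto 1 U f -> U x0 ->
  x @ G --> x0 -> v @ G --> v0 -> h @ G --> (0 : R) ->
  (\forall g \near G, h g != 0) ->
  (h g)^-1 *: (f (x g + h g *: v g) - f (x g)) @[g --> G] --> dderive f x0 v0.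
Proof.
move=> oU [cf [ex [cdf _]]] Ux0 cx cv ch h0.
apply/(ev_cvgP eF) => y Dy A yA.
have := cdf (x0, v0) (conj Ux0 I) => /(ev_cvgP eF) /(_ y Dy A yA).
move=> [[P Q] /= [[[W V] /= [nW nV] WVP] NQ] PQ].
have nWU : nbhs x0 (W `&` U) by apply: filterI => //; exact: open_nbhs_nbhs.
have seg := near_segment eE cx cv ch nWU.
have good : \forall g \near G, [/\ forall t, t \in `[0, 1]%R ->
    (W `&` U) (x g + t *: (h g *: v g)), V (v g) & h g != 0].
  by near=> g; split; near: g; [exact: seg|exact: cv|exact: h0].
exists ([set g | [/\ forall t, t \in `[0, 1]%R ->
    (W `&` U) (x g + t *: (h g *: v g)), V (v g) & h g != 0]],
    Q `&` ev_dom eF) => /=.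
  by split=> //; apply: filterI => //; exact: ev_nbhs_dom.
move=> [g z] /= [[sg Vg hg] [Qz Dz]].
have [|t t01 E'] := @ev_mean_value _ _ eF f (x g) (h g *: v g)
  (fun t => h g *: dderive f (x g + t *: (h g *: v g)) (v g)) z Dz.
  move=> t t01; apply: (has_dderiveZ eF); apply: has_dderive_dderive.
  by apply: ex; have [] := sg t t01.
rewrite evZ// evB// E' evZ// mulKf//.
have [Wt _] := sg t t01.
exact: (PQ (_, z) (conj (WVP (_, _) (conj Wt Vg)) Qz)).
Unshelve. all: by end_near. Qed.

Lemma smooth_upto_le E F (U : set E) (f : E -> F) k m : (k <= m)%N ->
  smooth_upto m U f -> smooth_upto k U f.
Proof.
elim: m k E F U f => [[]//|m IH] [|k] E F U f; rewrite ?ltnS => km.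
  by move=> [].
by move=> [cf [ex sf]]; split=> //; split=> //; exact: IH sf.
Qed.

Lemma cvg_line E (e : evaluations E) (x v : E) :
  x + h *: v @[h --> (0 : R)^'] --> x.
Proof.
have id0 : (id : R -> R) @ (0 : R)^' --> (0 : R) by exact: nbhs_dnbhs.
rewrite -[X in _ --> X]addr0 -(scale0r v); apply: (ev_cvgD e).
  exact: cvg_cst.
by apply: (ev_cvgZ e); [exact: id0|exact: cvg_cst].
Qed.

Lemma has_dderive_ext E F (eE : evaluations E) (U : set E) (f g : E -> F)
    x v l :
  open U -> (forall z, U z -> f z = g z) -> U x ->
  has_dderive f x v l -> has_dderive g x v l.
Proof.
move=> oU fg Ux; apply: cvg_trans; apply: near_eq_cvg; near=> h.
rewrite -!fg//; near: h; apply: (cvg_line eE); exact: open_nbhs_nbhs.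
Unshelve. all: by end_near. Qed.

Lemma dderive_ext E F (eE : evaluations E) (U : set E) (f g : E -> F) x v :
  open U -> (forall z, U z -> f z = g z) -> U x ->
  dderive f x v = dderive g x v.
Proof.
move=> oU fg Ux; congr xget; apply/seteqP; split=> l /=.
  exact: (has_dderive_ext eE oU).
by apply: (has_dderive_ext eE oU) => // z Uz; rewrite fg.
Qed.

Lemma open_cylinder E (U : set E) : open U ->
  open (U `*` [set: E] : set ((E * E)%type : preTopologicalLmodType R)).
Proof.
rewrite !openE => oU -[x v] [/= Ux _]; exists (U, setT) => //=.
by split; [exact: oU|exact: filterT].
Qed.

Lemma smooth_upto_ext k E F (eE : evaluations E) (U : set E) (f g : E -> F) :
  open U -> (forall z, U z -> f z = g z) ->
  smooth_upto k U f -> smooth_upto k U g.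
Proof.
elim: k E F eE U f g => [|k IH] E F eE U f g oU fg /= [cf sf].
  split=> // x Ux; rewrite /prop_for /continuous_at -fg//.
  apply: cvg_trans (cf x Ux); apply: near_eq_cvg.
  by apply: filterS (open_nbhs_nbhs (conj oU Ux)) => z; exact: fg.
split=> [x Ux|].
  rewrite /prop_for /continuous_at -fg//.
  apply: cvg_trans (cf x Ux); apply: near_eq_cvg.
  by apply: filterS (open_nbhs_nbhs (conj oU Ux)) => z; exact: fg.
have [ex sdf] := sf; split=> [x v Ux|].
  have [l fl] := ex x v Ux; exists l; exact: (has_dderive_ext eE oU fg Ux).
apply: IH sdf; [exact: ev_prod|exact: open_cylinder|].
by move=> [x v] [/= Ux _]; exact: (dderive_ext eE v oU fg Ux).
Qed.

Lemma dderiveZ E F (eF : evaluations F) (U : set E) (f : E -> F) x v (c : R) :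
  smooth_upto 1 U f -> U x -> dderive f x (c *: v) = c *: dderive f x v.
Proof.
move=> [_ [ex _]] Ux; apply: (dderive_eq eF); apply: (has_dderiveZ eF).
exact/has_dderive_dderive/ex.
Qed.

(** To go from [x] to [x + h (u + v)], first move along [h u] and then along [h
    v]: the second increment has a moving base point. *)
Lemma dderiveD E F (eE : evaluations E) (eF : evaluations F) (U : set E)
    (f : E -> F) x u v : open U -> smooth_upto 1 U f -> U x ->
  dderive f x (u + v) = dderive f x u + dderive f x v.
Proof.
move=> oU sf Ux; apply: (dderive_eq eF).
have [_ [ex _]] := sf.
have id0 : (id : R -> R) @ (0 : R)^' --> (0 : R) by exact: nbhs_dnbhs.
have cv : (fun=> v) @ (0 : R)^' --> v by exact: cvg_cst.
have S := strong_derivative eE eF oU sf Ux (@cvg_line E eE x u)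
  cv id0 (nbhs_dnbhs_neq (0 : R)).
rewrite /has_dderive.
apply: cvg_trans (ev_cvgD eF (has_dderive_dderive (ex x u Ux)) (S _)).
apply: near_eq_cvg; near=> h.
rewrite -scalerDr [h *: (u + v)]scalerDr [x + (_ + _)]addrA; congr (_ *: _).
by rewrite [LHS]addrC subrKA.
Unshelve. all: by end_near. Qed.

(** The increment of [g] is [h] times a moving direction that tends to [l]. *)
Lemma has_dderive_comp E F H (eF : evaluations F) (eH : evaluations H)
    (V : set F) (f : F -> H) (g : E -> F) x v l :
  open V -> smooth_upto 1 V f -> V (g x) -> has_dderive g x v l ->
  has_dderive (f \o g) x v (dderive f (g x) l).
Proof.
move=> oV sf Vg gl.
have id0 : (id : R -> R) @ (0 : R)^' --> (0 : R) by exact: nbhs_dnbhs.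
have cx : (fun=> g x) @ (0 : R)^' --> g x by exact: cvg_cst.
have S := strong_derivative eF eH oV sf Vg cx gl id0
  (nbhs_dnbhs_neq (0 : R)).
apply: cvg_trans (S _); apply: near_eq_cvg; near=> h => /=.
have h0 : h != 0 by near: h; exact: nbhs_dnbhs_neq.
by rewrite scalerA divff// scale1r [g x + _]addrC subrK.
Unshelve. all: by end_near. Qed.

Lemma has_dderive_lin E F (L : E -> F) x v :
  (forall a u w, L (a *: u + w) = a *: L u + L w) -> has_dderive L x v (L v).
Proof.
move=> linL; apply: cvg_near_cst; near=> h.
have h0 : h != 0 by near: h; exact: nbhs_dnbhs_neq.
by rewrite [x + _]addrC linL addrK scalerA mulVf// scale1r.
Unshelve. all: by end_near. Qed.

Lemma smooth_upto_lin k E F (eE : evaluations E) (eF : evaluations F)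
    (U : set E) (L : E -> F) :
  (forall a u w, L (a *: u + w) = a *: L u + L w) -> continuous L ->
  open U -> smooth_upto k U L.
Proof.
elim: k E eE U L => [|k IH] E eE U L linL cL oU.
  by split=> // x _; exact: cL.
split; first by move=> x _; exact: cL.
split; first by move=> x v _; exists (L v); exact: has_dderive_lin.
have -> : (fun p : E * E => dderive L p.1 p.2) = L \o snd.
  by apply/funext => p; apply: (dderive_eq eF); exact: has_dderive_lin.
apply: IH; [exact: ev_prod|by move=> a u w; exact: linL| |exact: open_cylinder].
move=> p; exact: (cvg_comp _ _ (@cvg_snd _ _ (nbhs p.1) (nbhs p.2) _) (cL p.2)).
Qed.

Lemma smooth_upto_cst k E F (eE : evaluations E) (eF : evaluations F)
    (U : set E) (c : F) : open U -> smooth_upto k U (fun=> c).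
Proof.
elim: k E eE U c => [|k IH] E eE U c oU.
  by split=> // x _; exact: cvg_cst.
have dc (x v : E) : has_dderive (fun=> c) x v 0.
  rewrite /has_dderive; under eq_fun do rewrite subrr scaler0.
  exact: cvg_cst.
split; first by move=> x _; exact: cvg_cst.
split; first by move=> x v _; exists 0.
have -> : (fun p : E * E => dderive (fun=> c) p.1 p.2) = fun=> 0.
  by apply/funext => p; exact: (dderive_eq eF).
by apply: IH; [exact: ev_prod|exact: open_cylinder].
Qed.

Lemma smooth_upto_pair k E F H (eE : evaluations E) (eF : evaluations F)
    (eH : evaluations H) (U : set E) (f : E -> F) (g : E -> H) :
  open U -> smooth_upto k U f -> smooth_upto k U g ->
  smooth_upto k U (fun x => (f x, g x)
    : ((F * H)%type : preTopologicalLmodType R)).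
Proof.
elim: k E eE U f g => [|k IH] E eE U f g oU [cf sf] [cg sg].
  by split=> // x Ux; apply: cvg_pair; [exact: cf|exact: cg].
split; first by move=> x Ux; apply: cvg_pair; [exact: cf|exact: cg].
have [exf sdf] := sf; have [exg sdg] := sg.
have D x v : U x -> has_dderive (fun x => (f x, g x)
    : ((F * H)%type : preTopologicalLmodType R)) x v
    (dderive f x v, dderive g x v).
  move=> Ux; apply: cvg_pair; first exact/has_dderive_dderive/exf.
  exact/has_dderive_dderive/exg.
split; first by move=> x v Ux; exists (dderive f x v, dderive g x v); exact: D.
apply: (@smooth_upto_ext k _ _ (ev_prod eE eE) _
  (fun p => (dderive f p.1 p.2, dderive g p.1 p.2)
    : ((F * H)%type : preTopologicalLmodType R))).
- exact: open_cylinder.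
- by move=> p [Up _]; apply/esym/(dderive_eq (ev_prod eF eH)); exact: D.
- apply: IH => //; [exact: ev_prod|exact: open_cylinder].
Qed.

(** The derivative of [f \o g] is the composite of the derivative of [f] with
    [(x, v) |-> (g x, Dg x v)], to which the induction hypothesis applies. The
    first component is again a composite, of [g] with a projection. *)
Theorem smooth_upto_comp k E F H (eE : evaluations E) (eF : evaluations F)
    (eH : evaluations H) (U : set E) (V : set F) (f : F -> H) (g : E -> F) :
  open U -> open V -> (forall x, U x -> V (g x)) ->
  smooth_upto k V f -> smooth_upto k U g -> smooth_upto k U (f \o g).
Proof.
elim: k E F H eE eF eH U V f g => [|k IH] E F H eE eF eH U V f g oU oV UV sf sg.
  have [cf _] := sf; have [cg _] := sg.
  by split=> // x Ux; exact: (cvg_comp _ _ (cg x Ux) (cf _ (UV _ Ux))).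
have [cf [exf sdf]] := sf; have [cg [exg sdg]] := sg.
split; first by move=> x Ux; exact: (cvg_comp _ _ (cg x Ux) (cf _ (UV _ Ux))).
have sf1 : smooth_upto 1 V f by exact: smooth_upto_le sf.
have D x v : U x ->
    has_dderive (f \o g) x v (dderive f (g x) (dderive g x v)).
  move=> Ux; apply: (has_dderive_comp eF eH oV sf1 (UV _ Ux)).
  exact/has_dderive_dderive/exg.
split; first by move=> x v Ux; eexists; exact: D.
pose eEE := ev_prod eE eE.
pose dg (p : E * E) : F * F := (g p.1, dderive g p.1 p.2).
apply: (@smooth_upto_ext k _ _ eEE _
  ((fun p : F * F => dderive f p.1 p.2) \o dg)).
- exact: open_cylinder.
- by move=> p [Up _]; apply/esym/(dderive_eq eH); exact: D.
- apply: (IH _ _ _ eEE (ev_prod eF eF) eH _ (V `*` setT)) => //.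
  + exact: open_cylinder.
  + exact: open_cylinder.
  + by move=> p [Up _]; split => //; exact: UV.
  + apply: smooth_upto_pair => //; [exact: open_cylinder|].
    apply: (IH _ _ _ eEE eE eF _ U g fst) => //.
    * exact: open_cylinder.
    * by move=> p [].
    * exact: smooth_upto_le sg.
    * apply: smooth_upto_lin => //; [by move=> p; exact: cvg_fst|].
      exact: open_cylinder.
Qed.

Lemma smooth_upto_id k E (eE : evaluations E) (U : set E) :
  open U -> smooth_upto k U (fun x : E => x).
Proof. by move=> oU; apply: smooth_upto_lin => // x; exact: cvg_id. Qed.

Lemma smooth_upto_fst k E F H (eE : evaluations E) (eF : evaluations F)
    (eH : evaluations H) (U : set E) (f : E -> F * H) : open U ->
  smooth_upto k U (f : E -> ((F * H)%type : preTopologicalLmodType R)) ->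
  smooth_upto k U (fun x => (f x).1).
Proof.
move=> oU sf; apply: (smooth_upto_comp eE (ev_prod eF eH) eF oU openT _ _ sf).
  by [].
apply: smooth_upto_lin openT => //; first exact: ev_prod.
by move=> p; exact: cvg_fst.
Qed.

Lemma smooth_upto_snd k E F H (eE : evaluations E) (eF : evaluations F)
    (eH : evaluations H) (U : set E) (f : E -> F * H) : open U ->
  smooth_upto k U (f : E -> ((F * H)%type : preTopologicalLmodType R)) ->
  smooth_upto k U (fun x => (f x).2).
Proof.
move=> oU sf; apply: (smooth_upto_comp eE (ev_prod eF eH) eH oU openT _ _ sf).
  by [].
apply: smooth_upto_lin openT => //; first exact: ev_prod.
by move=> p; exact: cvg_snd.
Qed.

Lemma smooth_upto_linear_comb k E F (eE : evaluations E) (eF : evaluations F)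
    (U : set E) (a : R) (f g : E -> F) : open U ->
  smooth_upto k U f -> smooth_upto k U g ->
  smooth_upto k U (fun x => a *: f x + g x).
Proof.
move=> oU sf sg.
apply: (smooth_upto_comp eE (ev_prod eF eF) eF oU openT _
  (f := fun p : F * F => a *: p.1 + p.2) _
  (smooth_upto_pair eE eF eF oU sf sg)) => //.
apply: smooth_upto_lin openT => //; first exact: ev_prod.
  by move=> b u v /=; rewrite !scalerDr !scalerA (mulrC a b) addrACA.
move=> p; apply: (ev_cvg_lin eF); first exact: cvg_cst.
  exact: cvg_fst.
exact: cvg_snd.
Qed.

End Calculus.

(** * Families of smooth functions on open subsets of R^n *)

Section SmoothFamilies.
Context {R : realType} {n : nat} {X : Type} (G : set_system X) {FG : Filter G}.
Variables (D : set X) (GD : G D) (g0 : X) (Dg0 : D g0).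
Variables (U : set 'rV[R]_n) (oU : open U).
Implicit Types f g : X -> 'rV[R]_n -> R^o.

(** The second clause is convergence of [f t] to [f g0] that is locally uniform
    on [U], stated as convergence jointly in the parameter and the point. With a
    one-point parameter space it only says that [f g0] is continuous, so that
    smoothness of a single function is a special case of the notions below. *)
Definition C1_family f :=
  (forall t z, D t -> U z -> {for z, continuous (f t)} /\
    forall i, derivable (f t) z (unit_row i)) /\
  (forall y, U y -> f p.1 p.2 @[p --> filter_prod G (nbhs y)] --> f g0 y).

Fixpoint Ck_family (k : nat) f : Prop :=
  C1_family f /\
  match k with
  | 0 => True
  | k'.+1 => forall i, Ck_family k' (fun t => 'D_(unit_row i) (f t))
  end.

Definition smooth_family f := forall k, Ck_family k f.

Lemma near_family (P : X -> 'rV[R]_n -> Prop) y : U y ->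
  (forall t z, D t -> U z -> P t z) ->
  \forall p \near filter_prod G (nbhs y), P p.1 p.2.
Proof.
move=> Uy DP; exists (D, U) => /=; first by split=> //; exact: open_nbhs_nbhs.
by move=> [t z] /= [Dt Uz]; exact: DP.
Qed.

Lemma C1_family_ext f g : (forall t z, D t -> U z -> f t z = g t z) ->
  C1_family f -> C1_family g.
Proof.
move=> fg [df cf]; split=> [t z Dt Uz|y Uy].
  have E : \near z, f t z = g t z.
    by apply: filterS (open_nbhs_nbhs (conj oU Uz)) => x; exact: fg.
  have [cfz dfz] := df t z Dt Uz; split.
    rewrite /prop_for /continuous_at -fg//.
    by apply: cvg_trans cfz; exact: (@near_eq_cvg _ _ (nbhs z) _ _ _ E).
  by move=> i; apply: near_eq_derivable (dfz i).
rewrite -fg//; apply: cvg_trans (cf y Uy); apply: near_eq_cvg.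
exact: (@near_family (fun t z => f t z = g t z) y Uy fg).
Qed.

Lemma Ck_family_ext k f g : (forall t z, D t -> U z -> f t z = g t z) ->
  Ck_family k f -> Ck_family k g.
Proof.
elim: k f g => [|k IH] f g fg [cf df]; split=> //; try exact: C1_family_ext cf.
move=> i; apply: IH (df i) => t z Dt Uz; apply: near_eq_derive.
by apply: filterS (open_nbhs_nbhs (conj oU Uz)) => x; exact: fg.
Qed.

Lemma Ck_familyS k f : Ck_family k.+1 f -> Ck_family k f.
Proof.
elim: k f => [|k IH] f [cf df]; first by split.
by split=> // i; exact/IH/df.
Qed.

Lemma Ck_familyD k f g : Ck_family k f -> Ck_family k g ->
  Ck_family k (fun t => f t + g t).
Proof.
elim: k f g => [|k IH] f g [cf df] [cg dg]; split=> //.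
1,2: split=> [t z Dt Uz|y Uy];
  last exact: (cvgD (cf.2 y Uy) (cg.2 y Uy)).
1,2: have [cft dft] := cf.1 t z Dt Uz; have [cgt dgt] := cg.1 t z Dt Uz;
  split=> [|i]; [exact: (cvgD cft cgt)|exact: derivableD].
move=> i; apply: Ck_family_ext (IH _ _ (df i) (dg i)) => t z Dt Uz.
have [_ dft] := cf.1 t z Dt Uz; have [_ dgt] := cg.1 t z Dt Uz.
by rewrite deriveD.
Qed.

Lemma Ck_familyM k f g : Ck_family k f -> Ck_family k g ->
  Ck_family k (fun t z => f t z * g t z).
Proof.
elim: k f g => [|k IH] f g Cf Cg.
all: have [cf df] := Cf; have [cg dg] := Cg.
all: split=> //.
1,2: split=> [t z Dt Uz|y Uy];
  last exact: (cvgM (cf.2 y Uy) (cg.2 y Uy)).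
1,2: have [cft dft] := cf.1 t z Dt Uz; have [cgt dgt] := cg.1 t z Dt Uz;
  split=> [|i]; [exact: (cvgM cft cgt)|exact: derivableM].
move=> i; have Sf := Ck_familyS Cf; have Sg := Ck_familyS Cg.
apply: Ck_family_ext (Ck_familyD (IH _ _ Sf (dg i)) (IH _ _ Sg (df i))).
move=> t z Dt Uz.
have [_ dft] := cf.1 t z Dt Uz; have [_ dgt] := cg.1 t z Dt Uz.
by apply/esym; rewrite [LHS]deriveM.
Qed.

Lemma Ck_familyN k f : Ck_family k f -> Ck_family k (fun t => - f t).
Proof.
elim: k f => [|k IH] f [cf df]; split=> //.
1,2: split=> [t z Dt Uz|y Uy]; last exact: (cvgN (cf.2 y Uy)).
1,2: have [cft dft] := cf.1 t z Dt Uz;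
  split=> [|i]; [exact: (cvgN cft)|exact: derivableN].
move=> i; apply: Ck_family_ext (IH _ (df i)) => t z Dt Uz.
by have [_ dft] := cf.1 t z Dt Uz; rewrite deriveN.
Qed.

(** The partial derivative of [1 / f] is [- Df (1 / f) (1 / f)], so only one
    order less is needed of [1 / f] itself. *)
Lemma Ck_familyV k f : (forall t z, D t -> U z -> f t z != 0) ->
  Ck_family k f -> Ck_family k (fun t z => (f t z)^-1).
Proof.
move=> f0; elim: k => [|k IH] Cf.
all: have [cf df] := Cf.
all: split=> //.
1,2: split=> [t z Dt Uz|y Uy];
  last exact: (cvgV (f0 _ _ Dg0 Uy) (cf.2 y Uy)).
1,2: have [cft dft] := cf.1 t z Dt Uz;
  split=> [|i]; [exact: (cvgV (f0 t z Dt Uz) cft)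
                |by apply: derivableV => //; exact: f0].
move=> i; have SV := IH (Ck_familyS Cf).
apply: Ck_family_ext (Ck_familyN (Ck_familyM (df i) (Ck_familyM SV SV))).
move=> t z Dt Uz; have [_ dft] := cf.1 t z Dt Uz.
apply/esym; rewrite [LHS]deriveV//; last exact: f0.
rewrite scaleNr -exprVn expr2; congr (- _); exact: mulrC.
Qed.

(** [partials] applies the head of the list last, hence the induction on lists
    from the right: the innermost derivative is the one absorbed in the family.
    *)
Lemma Ck_family_partials (s : seq 'I_n) f : Ck_family (size s) f ->
  C1_family (fun t => partials s (f t)).
Proof.
elim/last_ind: s f => [|s i IH] f; first by case.
rewrite size_rcons => -[_ /(_ i) /IH].
by under [in X in _ -> X]eq_fun do rewrite /partials foldr_rcons.
Qed.

Lemma smooth_familyP f :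
  smooth_family f <-> forall s, C1_family (fun t => partials s (f t)).
Proof.
split=> [sf s|H k]; first exact: Ck_family_partials.
elim: k f H => [|k IH] f H; split=> //; try exact: (H [::]).
move=> i; apply: IH => s; have := H (rcons s i).
by under [in X in X -> _]eq_fun do rewrite /partials foldr_rcons.
Qed.

End SmoothFamilies.

Lemma smooth_funE {R : realType} {n : nat} (U : set 'rV[R]_n)
    (f : 'rV[R]_n -> R^o) :
  smooth_fun U f <->
  smooth_family (globally [set tt]) setT tt U (fun=> f).
Proof.
rewrite smooth_familyP; split=> sf s.
  split=> [t z _ Uz|y Uy]; first exact: sf.
  have [cy _] := sf s y Uy.
  exact: (cvg_comp _ _ (@cvg_snd _ _ (globally [set tt]) (nbhs y) _) cy).
by move=> x Ux; exact: ((sf s).1 tt x I Ux).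
Qed.

(** * The topology of the space of n-forms *)

Lemma initial_cvgP (S : choiceType) (T : topologicalType) (f : S -> T)
    (F : set_system S) (s : S) : Filter F ->
  F --> (s : initial_topology f) <-> f @ F --> f s.
Proof.
move=> FF; split=> [Fs|Ffs].
  exact: cvg_trans (cvg_app f Fs) (@initial_continuous _ _ f s).
move=> A /= [_ [[B oB <-] Bfs BA]].
by apply: filterS BA _; apply: Ffs; exact: open_nbhs_nbhs.
Qed.

Lemma near_compact {X : Type} (G : set_system X) {FG : Filter G}
    (T : topologicalType) (K : set T) (P : X -> T -> Prop) :
  compact K ->
  (forall y, K y -> \forall p \near filter_prod G (nbhs y), P p.1 p.2) ->
  \forall t \near G, forall z, K z -> P t z.
Proof.
move=> /compact_near_coveringP cK KP.
apply: (cK X G P FG) => y Ky; have [[A B] /= [GA yB] AB] := KP y Ky.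
by exists (B, A) => //= -[z t] /= [Bz At]; exact: (AB (t, z)).
Qed.

Lemma compact_nbhs_row {R : realType} {n : nat} (U : set 'rV[R]_n) y :
  open U -> U y -> exists K, [/\ compact K, K `<=` U & nbhs y K].
Proof.
move=> oU Uy.
have /nbhs_closedballP[r rU] : nbhs y U by exact: open_nbhs_nbhs.
exists (closed_ball y r%:num); split=> //; last first.
  apply: filterS (nbhsx_ballx y r%:num _) => //; exact: subset_closed_ball.
apply: bounded_closed_compact; last exact: closed_ball_closed.
rewrite closed_ballE//; exists (`|y| + r%:num); split=> [|x xM z].
  exact: num_real.
rewrite /closed_ball_ /= => yz; apply/ltW/le_lt_trans/xM.
rewrite -[z in leLHS](subrK y) addrC; apply: le_trans (ler_normD _ _) _.
by rewrite lerD2l distrC.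
Qed.

Section FormTopology.
Context {R : realType} {n : nat} (M : closed_oriented_manifold R n).
Local Notation ix := (chart_ix M).

Lemma open_img (i : ix) : open (img i). Proof. exact: open_cimg. Qed.
Arguments open_img : clear implicits.

Lemma form_isform (w : nform M) : is_form w.
Proof. by apply/asboolP; exact: (valP w). Qed.

Definition chart_rep (w : nform M) (i : ix) : 'rV[R]_n -> R^o :=
  fun y => w i (psi i y).

Lemma chart_rep_smooth w i : smooth_fun (img i) (chart_rep w i).
Proof. by have [_ _] := form_isform w; apply. Qed.
Arguments chart_rep_smooth : clear implicits.

Lemma psiK (i : ix) y : img i y -> phi i (psi i y) = y /\ dom i (psi i y).
Proof. by move=> [x xi <-]; rewrite /psi /phi cmapK. Qed.

(** This unfolds the three layers of the definition of the topology of forms: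
    initial topology, product over charts and multi-indices, uniform convergence
    on compact sets. *)
Lemma form_cvgP (G : set_system (nform M)) (w : nform M) : Filter G ->
  G --> w <-> forall i s K, K `<=` img i -> compact K -> forall e, 0 < e ->
    \forall v \near G, forall z, K z ->
      `|partials s (chart_rep w i) z - partials s (chart_rep v i) z| < e.
Proof.
move=> FG.
have -> : (G --> w) = (G --> (w : initial_topology (@jets R n M))) by [].
rewrite initial_cvgP (@cvg_sup _ _ _ (@jets R n M @ G)); split=> H.
  move=> i s K Ki cK e e0.
  have := H (i, s); rewrite initial_cvgP => /fam_cvgP /(_ K (conj Ki cK)).
  move=> /(_ [set f | forall z, K z ->
    `|partials s (chart_rep w i) z - f z| < e]).
  apply; apply/uniform_nbhs; exists [set p | `|p.1 - p.2| < e].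
  by split => //; exact: (entourage_ball _ (PosNum e0)).
move=> -[i s]; rewrite initial_cvgP; apply/fam_cvgP => K [Ki cK] A.
move=> /uniform_nbhs [E []]; rewrite -entourage_ballE => -[e e0 eE] EA.
apply: filterS (H i s K Ki cK e e0) => v Kv; apply: EA => z Kz; apply: eE.
exact: Kv.
Qed.

(** Uniform convergence on a compact neighbourhood together with continuity of
    the limit gives joint convergence; conversely, joint convergence at each
    point of a compact set gives uniform convergence by compactness. *)
Lemma form_cvgE (G : set_system (nform M)) (w : nform M) : Filter G ->
  G --> w <-> forall i s y, img i y ->
    partials s (chart_rep p.1 i) p.2 @[p --> filter_prod G (nbhs y)] -->
    partials s (chart_rep w i) y.
Proof.
move=> FG; rewrite form_cvgP; split=> H i s.
  move=> y yi; have [K [cK Ki yK]] := compact_nbhs_row (open_img i) yi.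
  have [cw _] := chart_rep_smooth w i s y yi.
  apply/cvgrPdist_lt => e e0; have e20 : 0 < e / 2 by rewrite divr_gt0.
  have HK := H i s K Ki cK _ e20.
  move/cvgrPdist_lt: cw => /(_ _ e20) cw.
  near=> p; rewrite -(subrKA (partials s (chart_rep w i) p.2)).
  rewrite [e]splitr; apply: le_lt_trans (ler_normD _ _) _; apply: ltrD.
    by near: p; exact: (filter_prod2 cw).
  have Kp : K p.2 by near: p; exact: (filter_prod2 yK).
  have Hp : forall z, K z ->
      `|partials s (chart_rep w i) z - partials s (chart_rep p.1 i) z| < e / 2.
    by near: p; exact: (@filter_prod1 _ _ G (nbhs y) _ _ HK).
  exact: Hp.
move=> K Ki cK e e0; apply: near_compact => // y Ky.
have yi := Ki _ Ky; have [cw _] := chart_rep_smooth w i s y yi.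
have e20 : 0 < e / 2 by rewrite divr_gt0.
move/cvgrPdist_lt: cw => /(_ _ e20) cw.
have /cvgrPdist_lt /(_ _ e20) Hy := H i s y yi.
near=> p; rewrite -(subrKA (partials s (chart_rep w i) y)) [e]splitr.
apply: le_lt_trans (ler_normD _ _) _; apply: ltrD; last by near: p.
by rewrite distrC; near: p; exact: (filter_prod2 cw).
Unshelve. all: by end_near. Qed.

Definition form_ix := (ix * seq 'I_n * 'rV[R]_n)%type.
Definition form_dom : set form_ix := fun y => img y.1.1 y.2.
Definition form_nbhs (y : form_ix) : set_system form_ix :=
  pair y.1 @ nbhs y.2.
Definition form_ev (y : form_ix) (w : nform M) : R :=
  partials y.1.2 (chart_rep w y.1.1) y.2.

Definition ev_form : evaluations (nform M : preTopologicalLmodType R).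
Proof.
apply: (@Evaluations R (nform M) form_ix form_dom form_nbhs form_ev).
- by move=> [[i s] y] A /nbhs_singleton.
- move=> [[i s] y] /= yi; exact: (open_nbhs_nbhs (conj (open_img i) yi)).
- move=> [[i s] y] /= yi a u v.
  exact: (partials_lin a s (open_img i) (chart_rep_smooth u i)
    (chart_rep_smooth v i) yi).
- move=> u v uv; apply/val_inj/funext => i; apply/funext => x.
  have [xi|xi] := pselect (dom i x).
    have := uv (i, [::], phi i x).
    rewrite /form_ev /= /chart_rep /psi /phi cmapK//.
    by apply; exists x.
  have [u0 _ _] := form_isform u; have [v0 _ _] := form_isform v.
  by rewrite [LHS]u0// [RHS]v0.
- move=> G w FG; rewrite form_cvgE; split=> [H [[i s] y] /= yi A|H i s y yi A].
    move=> /(H i s y yi) [[P Q] /= [GP yQ] PQ].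
    exists (P, [set z | z.1 = (i, s) /\ Q z.2]) => /=.
      by split=> //; apply: filterS yQ => z Qz.
    by move=> [v [z1 z2]] /= [Pv [-> Qz]]; exact: (PQ (v, z2)).
  move=> /(H (i, s, y) yi) [[P Q] /= [GP yQ] PQ].
  exists (P, (pair (i, s)) @^-1` Q) => //= -[v z] /= [Pv Qz].
  exact: (PQ (v, (i, s, z))).
Defined.

Lemma chart_rep_family {X : Type} (G : set_system X) {FG : Filter G}
    (D : set X) t0 (u : X -> nform M) i : u @ G --> u t0 ->
  smooth_family G D t0 (img i) (fun t => chart_rep (u t) i).
Proof.
move=> cu; apply/smooth_familyP => s; split=> [t z Dt|y yi].
  exact: chart_rep_smooth.
have := (ev_cvgP ev_form _ _).1 cu (i, s, y) yi => H A /H.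
move=> [[P Q] /= [GP yQ] PQ]; exists (P, pair (i, s) @^-1` Q) => //.
by move=> [t z] [/= Pt Qz]; exact: (PQ (t, (i, s, z))).
Qed.

(** * Positive densities and the quotient of a product by a density *)

Lemma form_coef0 (w : nform M) i x : ~ dom i x -> w i x = 0.
Proof. by have [w0 _ _] := form_isform w; exact: w0. Qed.

Lemma form_eq (u v : nform M) : (forall i x, dom i x -> u i x = v i x) -> u = v.
Proof.
move=> uv; apply/val_inj/funext => i; apply/funext => x.
have [xi|xi] := pselect (dom i x); first exact: uv.
by rewrite [LHS]form_coef0// [RHS]form_coef0.
Qed.

Definition jacobian (i j : ix) (x : M) : R :=
  \det ('J (transition M i j) (phi i x)).

Lemma jacobian_gt0 i j x : dom i x -> dom j x -> 0 < jacobian i j x.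
Proof. exact: transition_oriented. Qed.

Lemma form_change (w : nform M) i j x : dom i x -> dom j x ->
  w i x = w j x * jacobian i j x.
Proof. by have [_ wJ _] := form_isform w; exact: wJ. Qed.

Lemma coef_gt0_chart (w : nform M) i j x : dom i x -> dom j x ->
  0 < w i x -> 0 < w j x.
Proof.
by move=> xi xj wi; rewrite (form_change w xj xi) mulr_gt0// jacobian_gt0.
Qed.

(** Positivity persists near each point of [M] for all forms close to [mu], and
    finitely many such neighbourhoods cover the compact manifold. *)
Lemma open_dens_pos : open (dens_pos M).
Proof.
rewrite openE => mu mu_gt0.
have cM := @mfd_compact R n M.
rewrite /interior.
suff H : \forall v \near mu, forall x : M, [set: M] x ->
    forall i, dom i x -> 0 < (v : nform M) i x.
  by apply: filterS H => v vx i x; exact: vx.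
apply: (@near_compact _ (nbhs mu) _ M setT
  (fun v x => forall i, dom i x -> 0 < (v : nform M) i x)) => // x _.
have [i xi] := mfd_cover x.
have phixi : img i (phi i x) by exists x.
have J := (@form_cvgE (nbhs mu) mu _).1 (@cvg_id _ _) i [::] _ phixi.
have mx : 0 < chart_rep mu i (phi i x).
  by rewrite /chart_rep /psi /phi cmapK//; exact: mu_gt0.
have [[A B] /= [nA nB] AB] := J _ _ (open_nbhs_nbhs (conj (@open_gt R 0) mx)).
exists (A, dom i `&` phi i @^-1` B) => /=.
  split=> //; apply: filterI; last exact: (cmap_continuous xi nB).
  exact: (open_nbhs_nbhs (conj (@open_cdom _ _ _ (mfd_chart M i)) xi)).
move=> [v z] /= [Av [zi Bz]] j zj; apply: (coef_gt0_chart zi zj).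
have := AB (v, phi i z) (conj Av Bz).
by rewrite /= /chart_rep /psi /phi cmapK.
Unshelve. all: by end_near. Qed.

Lemma dens_pos_neq0 (mu : nform M) i x : dens_pos M mu -> dom i x ->
  mu i x != 0.
Proof. by move=> mu_gt0 xi; rewrite gt_eqF// mu_gt0. Qed.

Lemma chart_at_dom (x : M) : dom (chart_at x) x.
Proof. by rewrite /dom /chart_at; case: cid. Qed.

(** The Jacobian of the change of charts cancels in the quotient. *)
Lemma radon_nikodymE (a mu : nform M) i x : dens_pos M mu -> dom i x ->
  radon_nikodym a mu x = a i x / mu i x.
Proof.
move=> mu0 xi; have xc := chart_at_dom x; rewrite /radon_nikodym.
rewrite (form_change a xc xi) (form_change mu xc xi).
by rewrite -mulf_div divff ?mulr1// lt0r_neq0// jacobian_gt0.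
Qed.

Definition quot_coef (mu a b : nform M) : ix -> M -> R :=
  fun i x => a i x * b i x / mu i x.

Lemma quot_family {X : Type} (G : set_system X) {FG : Filter G} (D : set X) t0
    (m u v : X -> nform M) i : G D -> D t0 ->
  (forall t, D t -> dens_pos M (m t)) ->
  smooth_family G D t0 (img i) (fun t => chart_rep (m t) i) ->
  smooth_family G D t0 (img i) (fun t => chart_rep (u t) i) ->
  smooth_family G D t0 (img i) (fun t => chart_rep (v t) i) ->
  smooth_family G D t0 (img i)
    (fun t y => quot_coef (m t) (u t) (v t) i (psi i y)).
Proof.
move=> GD Dt0 m0 sm su sv k; have oi := open_img i.
apply: (Ck_familyM GD Dt0 oi (Ck_familyM GD Dt0 oi (su k) (sv k))).
apply: (Ck_familyV GD Dt0 oi _ (sm k)) => t z Dt zi.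
exact: (dens_pos_neq0 (m0 t Dt) (psiK zi).2).
Qed.

Lemma quot_coef_form (mu a b : nform M) : dens_pos M mu ->
  is_form (quot_coef mu a b).
Proof.
move=> mu0; split=> [i x xi|i j x xi xj|i].
- by rewrite /quot_coef form_coef0// !mul0r.
- have J0 : jacobian i j x != 0 by rewrite lt0r_neq0// jacobian_gt0.
  have m0 := dens_pos_neq0 mu0 xj.
  rewrite -/(jacobian i j x) /quot_coef (form_change a xi xj).
  by rewrite (form_change b xi xj) (form_change mu xi xj); field; rewrite m0.
- have sf w := (smooth_funE _ _).1 (chart_rep_smooth w i).
  by apply/smooth_funE; apply: (quot_family (m := fun=> mu) (u := fun=> a)
    (v := fun=> b)).
Qed.

(** The form [a b / mu]; the default value 0 is only reached when [mu] is not
    positive. *)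
Definition form_quot (mu a b : nform M) : nform M :=
  insubd (0 : nform M) (quot_coef mu a b).

Lemma form_quotE mu a b i x : dens_pos M mu ->
  form_quot mu a b i x = a i x * b i x / mu i x.
Proof.
move=> mu0; rewrite /form_quot.
by rewrite [coef _](insubdK (0 : nform M) (asboolT (quot_coef_form a b mu0))).
Qed.

Local Notation E := (nform M : preTopologicalLmodType R).
Local Notation E3 := ((E * (E * E))%type : preTopologicalLmodType R).

Definition quot_dom : set (E * (E * E)) := [set p | dens_pos M p.1].

Lemma open_quot_dom : open (quot_dom : set E3).
Proof.
rewrite openE => -[mu p] /= mu0; exists (dens_pos M, setT) => /=.
  by split; [exact: (open_nbhs_nbhs (conj open_dens_pos mu0))|exact: filterT].
by move=> [v q] [].
Qed.

Definition quot3 (p : E * (E * E)) : E := form_quot p.1 p.2.1 p.2.2.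

Lemma quot3_continuous (p : E * (E * E)) : quot_dom p ->
  {for p, continuous (quot3 : E3 -> E)}.
Proof.
move=> Dp; apply/(ev_cvgP ev_form) => -[[i s] y] yi.
have nD : nbhs (p : E3) quot_dom.
  exact: (open_nbhs_nbhs (conj open_quot_dom Dp)).
have c1 : fst @ nbhs (p : E3) --> p.1 by exact: cvg_fst.
have c2 : snd @ nbhs (p : E3) --> p.2 by exact: cvg_snd.
have c21 : (fun q : E3 => q.2.1) @ nbhs (p : E3) --> p.2.1.
  exact: (cvg_comp _ _ c2 cvg_fst).
have c22 : (fun q : E3 => q.2.2) @ nbhs (p : E3) --> p.2.2.
  exact: (cvg_comp _ _ c2 cvg_snd).
have S := quot_family nD Dp (fun t Dt => Dt) (chart_rep_family quot_dom i c1)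
  (chart_rep_family quot_dom i c21) (chart_rep_family quot_dom i c22).
have Q : smooth_family (nbhs (p : E3)) quot_dom p (img i)
    (fun t => chart_rep (quot3 t) i).
  move=> k.
  apply: (Ck_family_ext nD Dp (open_img i) _ (S _ _ _ _ k)) => t z Dt zi.
  by rewrite /chart_rep form_quotE.
have [_ /(_ y yi) H] := (smooth_familyP _ _ _ _ _).1 Q s.
move=> A /H [[P B] /= [nP yB] PB].
exists (P, [set z | z.1 = (i, s) /\ B z.2]) => /=.
  by split=> //; apply: filterS yB => z Bz.
by move=> [v [z1 z2]] /= [Pv [-> Bz]]; exact: (PB (v, z2)).
Qed.

(** [a b / mu] is bilinear in [a] and [b], and [1 / (mu + h nu) - 1 / mu = - h
    nu / (mu (mu + h nu))]. *)
Lemma form_quot_incr (mu nu a b u v : nform M) (h : R) : h != 0 ->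
  dens_pos M mu -> dens_pos M (mu + h *: nu) ->
  h^-1 *: (form_quot (mu + h *: nu) (a + h *: u) (b + h *: v)
           - form_quot mu a b) =
  form_quot (mu + h *: nu) u (b + h *: v)
  + form_quot (mu + h *: nu) a v
  - form_quot (mu + h *: nu) (form_quot mu a b) nu.
Proof.
move=> h0 mu0 mu1; apply: form_eq => i x xi.
pose m' := mu + h *: nu; pose a' := a + h *: u; pose b' := b + h *: v.
have m'E : m' i x = mu i x + h * nu i x by [].
have a'E : a' i x = a i x + h * u i x by [].
have b'E : b' i x = b i x + h * v i x by [].
change (h^-1 * (form_quot m' a' b' i x - form_quot mu a b i x) =
  form_quot m' u b' i x + form_quot m' a v i x
  - form_quot m' (form_quot mu a b) nu i x).
have key q1 q0 q2 q3 q4 : q1 = a' i x * b' i x / m' i x ->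
    q0 = a i x * b i x / mu i x -> q2 = u i x * b' i x / m' i x ->
    q3 = a i x * v i x / m' i x -> q4 = q0 * nu i x / m' i x ->
    h^-1 * (q1 - q0) = q2 + q3 - q4.
  have m0 := dens_pos_neq0 mu0 xi; have := dens_pos_neq0 mu1 xi.
  rewrite -/m' m'E a'E b'E => m1 -> -> -> -> ->; field.
  by rewrite h0 m0 m1.
by apply: key; exact: form_quotE.
Qed.

Definition quot3_deriv (p v : E * (E * E)) : E :=
  quot3 (p.1, (v.2.1, p.2.2)) + quot3 (p.1, (p.2.1, v.2.2))
  - quot3 (p.1, (quot3 p, v.1)).

Lemma has_dderive_quot3 (p v : E3) : quot_dom p ->
  has_dderive (quot3 : E3 -> E) p v (quot3_deriv p v).
Proof.
move=> Dp.
have cl := @cvg_line _ _ (ev_prod ev_form (ev_prod ev_form ev_form)) p v.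
have c1 : (p + h *: v).1 @[h --> (0 : R)^'] --> p.1.
  exact: (cvg_comp _ _ cl cvg_fst).
have c2 : (p + h *: v).2 @[h --> (0 : R)^'] --> p.2.
  exact: (cvg_comp _ _ cl cvg_snd).
have c22 : (p + h *: v).2.2 @[h --> (0 : R)^'] --> p.2.2.
  exact: (cvg_comp _ _ c2 cvg_snd).
have Q (f g : R -> E) (a b : E) : f @ (0 : R)^' --> a -> g @ (0 : R)^' --> b ->
    quot3 ((p + h *: v).1, (f h, g h)) @[h --> (0 : R)^'] -->
    quot3 (p.1, (a, b)).
  move=> fa gb; have Dq : quot_dom (p.1, (a, b)) by [].
  apply: (cvg_comp (fun h => ((p + h *: v).1, (f h, g h))) (quot3 : E3 -> E) _
    (quot3_continuous Dq)).
  exact: (cvg_pair c1 (cvg_pair fa gb)).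
have cst (a : E) : (fun=> a) @ (0 : R)^' --> a by exact: cvg_cst.
have L := ev_cvgB ev_form (ev_cvgD ev_form (Q _ _ _ _ (cst v.2.1) c22)
  (Q _ _ _ _ (cst p.2.1) (cst v.2.2))) (Q _ _ _ _ (cst (quot3 p)) (cst v.1)).
apply: cvg_trans (L _ _); apply: near_eq_cvg; near=> h.
have h0 : h != 0 by near: h; exact: nbhs_dnbhs_neq.
have Dh : quot_dom (p + h *: v).
  by near: h; exact: (cl _ (open_nbhs_nbhs (conj open_quot_dom Dp))).
exact/esym/form_quot_incr.
Unshelve. all: by end_near. Qed.

(** The derivative is a combination of the map itself composed with linear maps
    and with itself, hence is as smooth as the map is already known to be. *)
Theorem smooth_upto_quot3 k :
  smooth_upto k (quot_dom : set E3) (quot3 : E3 -> E).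
Proof.
pose e3 := ev_prod ev_form (ev_prod ev_form ev_form).
elim: k => [|k IH]; first by split=> // p; exact: quot3_continuous.
split; first by move=> p; exact: quot3_continuous.
split.
  by move=> p v Dp; exists (quot3_deriv p v); exact: has_dderive_quot3.
have oD := open_cylinder open_quot_dom.
set V := _ `*` _ in oD *.
pose e6 := ev_prod e3 e3.
apply: (@smooth_upto_ext _ k _ _ e6 V (fun p => quot3_deriv p.1 p.2)) => //.
  by move=> [p v] [/= Dp _]; apply/esym/(dderive_eq ev_form);
    exact: has_dderive_quot3.
have sp : smooth_upto k V fst.
  by apply: (smooth_upto_fst e6 e3 e3) => //; exact: smooth_upto_id.
have sv : smooth_upto k V snd.
  by apply: (smooth_upto_snd e6 e3 e3) => //; exact: smooth_upto_id.
have e2 := ev_prod ev_form ev_form.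
have sp1 := smooth_upto_fst e6 ev_form e2 oD sp.
have sp2 := smooth_upto_snd e6 ev_form e2 oD sp.
have sp21 := smooth_upto_fst e6 ev_form ev_form oD sp2.
have sp22 := smooth_upto_snd e6 ev_form ev_form oD sp2.
have sv1 := smooth_upto_fst e6 ev_form e2 oD sv.
have sv2 := smooth_upto_snd e6 ev_form e2 oD sv.
have sv21 := smooth_upto_fst e6 ev_form ev_form oD sv2.
have sv22 := smooth_upto_snd e6 ev_form ev_form oD sv2.
have Q (f g : E3 * E3 -> E) : smooth_upto k V f -> smooth_upto k V g ->
    smooth_upto k V (fun p => quot3 (p.1.1, (f p, g p))).
  move=> sf sg.
  apply: (smooth_upto_comp e6 e3 ev_form oD open_quot_dom _ IH
    (smooth_upto_pair e6 ev_form e2 oD sp1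
      (smooth_upto_pair e6 ev_form ev_form oD sf sg))).
  by move=> p [].
have sq : smooth_upto k V (fun p => quot3 p.1).
  by apply: (smooth_upto_comp e6 e3 ev_form oD open_quot_dom _ IH sp) => p [].
have S1 := smooth_upto_linear_comb e6 ev_form 1 oD (Q _ _ sv21 sp22)
  (Q _ _ sp21 sv22).
have S2 := smooth_upto_linear_comb e6 ev_form (-1) oD (Q _ _ sq sv1) S1.
apply: (smooth_upto_ext e6 oD _ S2) => p _.
by rewrite /quot3_deriv scaleN1r scale1r addrC.
Qed.

End FormTopology.

(** * Iterated integrals of continuous functions with compact support *)

Section OneDim.
Context {R : realType}.
Local Notation mu := (@lebesgue_measure R).
Implicit Types f : R -> R.

Definition supported {V : normedModType R} (r : R) (f : V -> R) :=
  continuous f /\ forall x, r < `|x| -> f x = 0.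

Lemma supported_restrict r f : supported r f -> f \_ `[- r, r] = f.
Proof.
move=> [_ f0]; apply/funext => x; rewrite patchE; case: ifPn => // xr.
apply/esym/f0; rewrite ltNge; apply: contra xr => xr.
by rewrite inE/= in_itv/= -ler_norml.
Qed.

Lemma supported_integrable r f : supported r f ->
  mu.-integrable setT (EFin \o f).
Proof.
move=> sf.
have mI : measurable (`[- r, r]%classic : set (measurableTypeR R)).
  exact: measurable_itv.
rewrite -(supported_restrict sf) -restrict_EFin.
apply/(integrable_restrict _ mI) => //.
rewrite setTI; apply: continuous_compact_integrable.
  exact: segment_compact.
by apply: continuous_subspaceT; exact: sf.1.
Qed.

Lemma fine_itv_measure (a b : R) : a <= b ->
  fine (mu `[a, b]%classic) = b - a.
Proof.
move=> ab; rewrite lebesgue_measure_itv/= lte_fin.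
case: ltP => [//|ba] /=; apply/esym/eqP; rewrite subr_eq0.
by rewrite eq_le ba ab.
Qed.

Lemma supported_integral_bound r f e : 0 <= r -> supported r f ->
  (forall x, `|f x| <= e) -> `|\int[mu]_x f x| <= e * (2 * r).
Proof.
move=> r0 sf fe; rewrite -[in leLHS](supported_restrict sf) -Rintegral_mkcond.
have mI : measurable (`[- r, r]%classic : set (measurableTypeR R)).
  exact: measurable_itv.
have fi : mu.-integrable `[- r, r] (EFin \o f).
  by apply: integrableS (supported_integrable sf) => //; exact: measurable_itv.
apply: le_trans (le_normr_Rintegral mI fi) _.
have -> : 2 * r = fine (mu `[- r, r]%classic).
  by rewrite fine_itv_measure ?ge0_cp//; ring.
rewrite -Rintegral_cst//; apply: le_Rintegral => //.
- exact: (integrable_norm fi).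
- apply: continuous_compact_integrable; first exact: segment_compact.
  by apply: continuous_subspaceT => x; exact: cvg_cst.
Qed.

(** A positive value at [x] gives a lower bound [f x / 2] on an interval around
    [x]. *)
Lemma supported_integral_eq0 r f : supported r f -> (forall x, 0 <= f x) ->
  \int[mu]_x f x = 0 -> forall x, f x = 0.
Proof.
move=> sf f0 I0 x; apply/eqP; rewrite eq_le f0 andbT leNgt; apply/negP => fx.
have fx2 : 0 < f x / 2 by rewrite divr_gt0.
have /cvgrPdist_lt /(_ _ fx2) /nbhs_ballP[d /= d0 fd] := sf.1 x.
have d20 : 0 < d / 2 by rewrite divr_gt0.
pose A : set (measurableTypeR R) := `[x - d / 2, x + d / 2]%classic.
have mA : measurable A by exact: measurable_itv.
have fi := supported_integrable sf.
have fiA : mu.-integrable A (EFin \o f) by exact: integrableS fi.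
have fA y : A y -> f x / 2 <= f y.
  rewrite /A /= in_itv/= => /andP[y1 y2].
  have : `|f x - f y| < f x / 2.
    by apply: fd; rewrite /ball/= ltr_norml; apply/andP; split; lra.
  by rewrite ltr_norml => /andP[]; lra.
have IA : \int[mu]_(y in A) f y <= 0.
  rewrite -I0 -(setUv A) Rintegral_setU//.
  - by rewrite lerDl; exact: Rintegral_ge0.
  - exact: measurableC.
  - by rewrite setUv.
  - exact/disj_setPCl.
have : \int[mu]_(y in A) (f x / 2) <= \int[mu]_(y in A) f y.
  apply: le_Rintegral => //.
  apply: continuous_compact_integrable; first exact: segment_compact.
  by apply: continuous_subspaceT => y; exact: cvg_cst.
have Ad : fine (mu A) = d by rewrite fine_itv_measure; lra.
rewrite Rintegral_cst// Ad => /le_trans /(_ IA).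
by rewrite leNgt mulr_gt0.
Qed.
End OneDim.

Section Rows.
Context {R : realType}.

Lemma mx_norm_leP m n (A : 'M[R]_(m, n)) r : 0 <= r ->
  reflect (forall i j, `|A i j| <= r) (`|A| <= r).
Proof.
move=> r0; rewrite [`|A|]mx_normrE; apply: (iffP (bigmax_leP _ _ _ _)).
  by move=> [_ H] i j; exact: (H (i, j)).
by move=> H; split.
Qed.

Lemma mx_coord_le m n (A : 'M[R]_(m, n)) i j : `|A i j| <= `|A|.
Proof. by move: i j; apply/mx_norm_leP. Qed.

Lemma norm_row_mx n (t : R) (y : 'rV[R]_n) :
  `|row_mx (t%:M : 'rV[R]_1) y| = Num.max `|t| `|y|.
Proof.
apply/eqP; rewrite eq_le ge_max; apply/andP; split.
  apply/mx_norm_leP; first by rewrite le_max normr_ge0.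
  move=> i j; rewrite le_max; case: (split_ordP j) => k ->.
    by rewrite row_mxEl !ord1 mxE eqxx mulr1n lexx.
  rewrite row_mxEr; apply/orP; right.
  exact: mx_coord_le.
have le_coord := mx_coord_le (row_mx (t%:M : 'rV[R]_1) y).
apply/andP; split.
  by have := le_coord ord0 (lshift n ord0); rewrite row_mxEl mxE eqxx mulr1n.
apply/mx_norm_leP => // i j.
by have := le_coord i (rshift 1 j); rewrite row_mxEr.
Qed.

Lemma row_mx_continuous n :
  continuous (fun p : R * 'rV[R]_n => row_mx (p.1%:M : 'rV[R]_1) p.2).
Proof.
move=> [t y]; apply/cvgrPdist_lt => e e0; near=> p => /=.
rewrite opp_row_mx add_row_mx -raddfB norm_row_mx gt_max; apply/andP; split.
  near: p.
  have /cvgrPdist_lt /(_ e e0) H : p.1 @[p --> (t, y)] --> t by exact: cvg_fst.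
  exact: H.
near: p.
have /cvgrPdist_lt /(_ e e0) H : p.2 @[p --> (t, y)] --> y by exact: cvg_snd.
exact: H.
Unshelve. all: by end_near. Qed.

End Rows.

Section IteratedIntegral.
Context {R : realType}.
Local Notation mu := (@lebesgue_measure R).

Lemma supported_lin {V : normedModType R} r (f g : V -> R) c :
  supported r f -> supported r g -> supported r (fun y => f y + c * g y).
Proof.
move=> [cf f0] [cg g0]; split=> [x|x rx]; last by rewrite f0// g0// mulr0 addr0.
by apply: cvgD; [exact: cf|apply: cvgM; [exact: cvg_cst|exact: cg]].
Qed.

Definition slice n (f : 'rV[R]_n.+1 -> R) (t : R) (y : 'rV[R]_n) : R :=
  f (row_mx (t%:M : 'rV[R]_1) y).

Lemma supported_slice n r (f : 'rV[R]_n.+1 -> R) t :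
  supported r f -> supported r (slice f t).
Proof.
move=> [cf f0]; split=> [y|y ry].
  have ct : (fun z : 'rV[R]_n => (t, z)) @ y --> (t, y).
    have c1 : (fun=> t) @ nbhs y --> t by exact: (@cvg_cst _ t _ (nbhs y) _).
    exact: (cvg_pair c1 (@cvg_id _ (nbhs y))).
  exact: (cvg_comp _ _ ct
    (cvg_comp _ _ (@row_mx_continuous R n (t, y)) (cf _))).
by apply: f0; rewrite norm_row_mx lt_max ry orbT.
Qed.

Lemma slice_eq0 n r (f : 'rV[R]_n.+1 -> R) t :
  supported r f -> r < `|t| -> slice f t = fun=> 0.
Proof.
move=> [_ f0] rt; apply/funext => y; apply: f0.
by rewrite norm_row_mx lt_max rt.
Qed.

Lemma row_mx_surj n (x : 'rV[R]_n.+1) :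
  exists t y, x = row_mx (t%:M : 'rV[R]_1) y.
Proof.
exists ((lsubmx (x : 'rV[R]_(1 + n))) ord0 ord0), (rsubmx (x : 'rV[R]_(1 + n))).
by rewrite -mx11_scalar hsubmxK.
Qed.

(** Joint continuity gives uniformity on the compact ball that contains the
    supports of all slices; outside of it both slices vanish. *)
Lemma slice_cvg n r (f : 'rV[R]_n.+1 -> R) t0 e : supported r f -> 0 < e ->
  \forall t \near t0, forall y, `|slice f t0 y - slice f t y| <= e.
Proof.
move=> sf e0; have [cf f0] := sf.
pose K := [set y : 'rV[R]_n | `|y| <= r].
have cK : compact K.
  apply: bounded_closed_compact.
    exists r; split=> [|s rs y Ky]; first exact: num_real.
    exact: le_trans (ltW rs).
  exact: (closed_comp (fun y _ => @norm_continuous _ _ y) (@closed_le R r)).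
have H : \forall t \near t0, forall y, K y ->
    `|slice f t0 y - slice f t y| <= e.
  apply: (@near_compact _ (nbhs t0) _ _ K
    (fun t y => `|slice f t0 y - slice f t y| <= e)) => // y Ky.
  have cy : (fun p => f (row_mx (p.1%:M : 'rV[R]_1) p.2)) @ (t0, y)
      --> f (row_mx (t0%:M : 'rV[R]_1) y).
    exact: (cvg_comp _ _ (@row_mx_continuous R n (t0, y)) (cf _)).
  have e20 : 0 < e / 2 by rewrite divr_gt0.
  have /cvgrPdist_lt /(_ _ e20) H1 := cy.
  have [sc _] := supported_slice t0 sf.
  have /cvgrPdist_lt /(_ _ e20) H2 := sc y.
  near=> p; rewrite -(subrKA (slice f t0 y)) [e]splitr.
  apply: le_trans (ler_normD _ _) _; apply: lerD; apply: ltW.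
    rewrite distrC; near: p.
    exact: (@filter_prod2 _ _ (nbhs t0) (nbhs y) _ _ H2).
  by near: p.
apply: filterS H => t Ht y; have [|ry] := leP `|y| r; first exact: Ht.
have [_ h1] := supported_slice t0 sf; have [_ h2] := supported_slice t sf.
by rewrite h1// h2// subrr normr0 ltW.
Unshelve. all: by end_near. Qed.

(** The three properties are proved together: linearity and the bound in
    dimension [n] are what makes the inner integral a continuous function of the
    remaining variable, to which the one-dimensional results apply. *)
Let int_ok n :=
  [/\ forall r (f g : 'rV[R]_n -> R) c, 0 <= r ->
        supported r f -> supported r g ->
        int_rV (fun y => f y + c * g y) = int_rV f + c * int_rV g,
      forall r (f : 'rV[R]_n -> R) e, 0 <= r -> supported r f ->
        (forall x, `|f x| <= e) -> `|int_rV f| <= e * (2 * r) ^+ n &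
      forall r (f : 'rV[R]_n -> R), 0 <= r -> supported r f ->
        (forall x, 0 <= f x) ->
        0 <= int_rV f /\ (int_rV f = 0 -> forall x, f x = 0)].

Lemma slice_integral_supported n r (f : 'rV[R]_n.+1 -> R) :
  int_ok n -> 0 <= r -> supported r f ->
  supported r (fun t => int_rV (slice f t)).
Proof.
move=> [lin bnd _] r0 sf; split=> [t0|t rt]; last first.
  rewrite (slice_eq0 sf rt).
  have s0 : supported r (fun=> 0 : R) by split=> // x; exact: cvg_cst.
  have := bnd r (fun=> 0) 0 r0 (s0 _) (fun x => _).
  by rewrite mul0r normr0 => /(_ (fun=> lexx _)); rewrite normr_le0 => /eqP.
apply/cvgrPdist_lt => e e0.
(* The 1 makes [C] positive even if [r = 0]. *)
pose C := (2 * r) ^+ n + 1.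
have C0 : 0 < C by rewrite ltr_wpDl// exprn_ge0// mulr_ge0.
have e10 : 0 < e / C by rewrite divr_gt0.
apply: filterS (slice_cvg t0 sf e10) => t Ht.
have st := supported_slice t sf; have st0 := supported_slice t0 sf.
have -> : int_rV (slice f t0) - int_rV (slice f t) =
    int_rV (fun y => slice f t0 y + (-1) * slice f t y).
  by rewrite (lin r)// mulN1r.
apply: le_lt_trans (bnd r _ (e / C) r0 (supported_lin (-1) st0 st) _) _.
  by move=> y; rewrite mulN1r.
rewrite mulrAC ltr_pdivrMr// ltr_pM2l// /C; lra.
Qed.

Lemma int_rV_ok n : int_ok n.
Proof.
elim: n => [|n IH]; first split=> //=.
- by move=> r f e r0 sf fe; rewrite expr0 mulr1.
- move=> r f r0 sf f0; split=> // E x.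
  by rewrite (_ : x = 0)//; apply/rowP => -[].
have [lin bnd pos] := IH; split.
- move=> r f g c r0 sf sg /=.
  have If := slice_integral_supported IH r0 sf.
  have Ig := slice_integral_supported IH r0 sg.
  rewrite -RintegralZl//; last exact: supported_integrable Ig.
  rewrite -RintegralD//; last 2 first.
  + exact: supported_integrable If.
  + apply: (@supported_integrable _ r); split=> [t|t rt].
      by apply: cvgM; [exact: cvg_cst|exact: Ig.1].
    by rewrite Ig.2// mulr0.
  apply: eq_Rintegral => t _.
  exact: (lin r _ _ c r0 (supported_slice t sf) (supported_slice t sg)).
- move=> r f e r0 sf fe /=.
  have If := slice_integral_supported IH r0 sf.
  rewrite exprS mulrCA mulrC -mulrA mulrC.
  rewrite [leRHS](_ : _ = (e * (2 * r) ^+ n) * (2 * r)); last by ring.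
  apply: supported_integral_bound => // t.
  apply: (bnd r _ e r0 (supported_slice t sf)) => y.
  exact: fe.
- move=> r f r0 sf f0 /=.
  have If := slice_integral_supported IH r0 sf.
  have It t : 0 <= int_rV (slice f t) /\ (int_rV (slice f t) = 0 ->
      forall x, slice f t x = 0).
    by apply: (pos r _ r0 (supported_slice t sf)) => y; exact: f0.
  split; first by apply: Rintegral_ge0 => t _; have [] := It t.
  move=> E x; have [t [y ->]] := row_mx_surj x.
  have [_] := It t; apply.
  by apply: (supported_integral_eq0 If) => // s; have [] := It s.
Qed.

End IteratedIntegral.

Section IntRVTheory.
Context {R : realType} {n : nat}.
Variable r : R.
Hypothesis r0 : 0 <= r.
Implicit Types f g : 'rV[R]_n -> R.

Lemma int_rV_lin f g c : supported r f -> supported r g ->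
  int_rV (fun y => f y + c * g y) = int_rV f + c * int_rV g.
Proof. by move=> sf sg; have [lin _ _] := @int_rV_ok R n; exact: (lin r). Qed.

Lemma int_rV_bound f e : supported r f -> (forall x, `|f x| <= e) ->
  `|int_rV f| <= e * (2 * r) ^+ n.
Proof. by move=> sf fe; have [_ bnd _] := @int_rV_ok R n; exact: bnd. Qed.

Lemma int_rV_ge0 f : supported r f -> (forall x, 0 <= f x) -> 0 <= int_rV f.
Proof. by move=> sf f0; have [_ _ /(_ r f r0 sf f0)[]] := @int_rV_ok R n. Qed.

Lemma int_rV_eq0 f : supported r f -> (forall x, 0 <= f x) ->
  int_rV f = 0 -> forall x, f x = 0.
Proof. by move=> sf f0; have [_ _ /(_ r f r0 sf f0)[]] := @int_rV_ok R n. Qed.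

Lemma int_rV_cvg {X : Type} (G : set_system X) {FG : Filter G}
    (f : X -> 'rV[R]_n -> R) (f0 : 'rV[R]_n -> R) :
  (\forall t \near G, supported r (f t)) -> supported r f0 ->
  (forall e, 0 < e -> \forall t \near G, forall y, `|f0 y - f t y| <= e) ->
  int_rV (f t) @[t --> G] --> int_rV f0.
Proof.
move=> sf sf0 ff; apply/cvgrPdist_lt => e e0.
(* The 1 makes [C] positive even if [r = 0]. *)
pose C := (2 * r) ^+ n + 1.
have C0 : 0 < C by rewrite ltr_wpDl// exprn_ge0// mulr_ge0.
have e10 : 0 < e / C by rewrite divr_gt0.
apply: filterS2 sf (ff _ e10) => t sft Ht.
have -> : int_rV f0 - int_rV (f t) = int_rV (fun y => f0 y + (-1) * f t y).
  by rewrite int_rV_lin// mulN1r.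
have bnd y : `|f0 y + (-1) * f t y| <= e / C by rewrite mulN1r.
apply: le_lt_trans (int_rV_bound (supported_lin (-1) sf0 sft) bnd) _.
by rewrite mulrAC ltr_pdivrMr// ltr_pM2l// /C ltrDl.
Qed.

End IntRVTheory.

(** * Integration over the manifold *)

Section ManifoldIntegral.
Context {R : realType} {n : nat} (M : closed_oriented_manifold R n).
Local Notation ix := (chart_ix M).
Implicit Types w : ix -> M -> R.

Definition continuous_coef w := forall i y, img i y ->
  {for y, continuous (fun z => w i (psi i z) : R^o)}.

Lemma phi_continuous (i : ix) x : dom i x -> {for x, continuous (phi i)}.
Proof. exact: cmap_continuous. Qed.

Lemma psi_continuous (i : ix) y : img i y -> {for y, continuous (psi i)}.
Proof. by move=> [x xi <-]; exact: cinv_continuous. Qed.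

Lemma phiK (i : ix) x : dom i x -> psi i (phi i x) = x.
Proof. exact: cmapK. Qed.

Definition pou_term (P : partition_of_unity M) (k : 'I_(pou_size P)) w
    (y : 'rV[R]_n) : R :=
  \1_(img (pou_ix k)) y *
    (pou_fun k (psi (pou_ix k) y) * w (pou_ix k) (psi (pou_ix k) y)).

Section OneTerm.
Variables (P : partition_of_unity M) (k : 'I_(pou_size P)).
Let i := pou_ix k.

(** The image in the chart of the support of the k-th function of the partition,
    a compact set outside which the k-th term of the integral vanishes. *)
Definition pou_compact : set 'rV[R]_n :=
  phi i @` closure [set x | pou_fun k x != 0].

Lemma pou_compactP : [/\ compact pou_compact, pou_compact `<=` img i &
  forall w y, ~ pou_compact y -> pou_term k w y = 0].
Proof.
have sub := @pou_support _ _ _ P k; split.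
- apply: continuous_compact.
    apply: continuous_in_subspaceT => x /set_mem xS.
    exact: phi_continuous (sub _ xS).
  exact: (subclosed_compact (@closed_closure _ _) (@mfd_compact R n M)).
- by move=> _ [x xS <-]; exists x => //; exact: sub.
- move=> w y Ky; rewrite /pou_term indicE -/i.
  case: (boolP (y \in img i)) => [/set_mem yi|_]; last by rewrite mul0r.
  case: (eqVneq (pou_fun k (psi i y)) 0) => [->|nz].
    by rewrite mul0r mulr0.
  exfalso; apply: Ky; exists (psi i y); first exact: subset_closure.
  by have [] := psiK yi.
Qed.

Lemma pou_le1 x : pou_fun k x <= 1.
Proof.
rewrite -(pou_sum P x) (bigD1 k)//= lerDl; apply: sumr_ge0 => j _.
exact: pou_ge0.
Qed.

(** The term is continuous on the open image of the chart, and zero on the open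
    complement of [pou_compact]; these two sets cover R^n. *)
Lemma pou_term_continuous w : continuous_coef w -> continuous (pou_term k w).
Proof.
move=> cw y; have [cK Ki K0] := pou_compactP.
have [yi|yi] := pselect (img i y).
  have E : \near y, pou_fun k (psi i y) * w i (psi i y) = pou_term k w y.
    apply: filterS (open_nbhs_nbhs (conj (@open_img R n M i) yi)) => z zi.
    by rewrite /pou_term indicE mem_set// mul1r.
  rewrite /continuous_at -(nbhs_singleton E).
  apply: cvg_trans (@near_eq_cvg _ _ (nbhs y) _ _ _ E) _.
  apply: cvgM; last exact: cw.
  exact: (cvg_comp _ _ (psi_continuous yi) (@pou_continuous _ _ _ P k _)).
have Ky : ~ pou_compact y by move=> /Ki.
have oK : open (~` pou_compact).
  by apply: closed_openC; apply: compact_closed => //; exact: norm_hausdorff.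
have E : \near y, 0 = pou_term k w y.
  by apply: filterS (open_nbhs_nbhs (conj oK Ky)) => z zK; rewrite K0.
rewrite /continuous_at -(nbhs_singleton E).
apply: cvg_trans (@near_eq_cvg _ _ (nbhs y) _ _ _ E) _.
exact: cvg_cst.
Qed.

Lemma pou_radius : exists2 r : R, 0 <= r &
  forall w, continuous_coef w -> supported r (pou_term k w).
Proof.
have [cK Ki K0] := pou_compactP.
have [r [rr Kr]] := compact_bounded cK.
(* [compact_bounded] only bounds the norm by the numbers above [r]. *)
exists (`|r| + 1) => [|w cw]; first by rewrite addr_ge0.
split; first exact: pou_term_continuous.
move=> y ry; apply: K0 => Ky; move: ry; rewrite ltNge => /negP; apply.
by apply: Kr => //; rewrite (le_lt_trans (ler_norm _))// ltrDl.
Qed.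

End OneTerm.
Section PouIntegral.
Variable P : partition_of_unity M.

Lemma continuous_coef_lin w w' (c : R) :
  continuous_coef w -> continuous_coef w' ->
  continuous_coef (fun i x => w i x + c * w' i x).
Proof.
move=> cw cw' i y yi.
exact: (cvgD (cw i y yi) (cvgM (@cvg_cst _ c _ (nbhs y) _) (cw' i y yi))).
Qed.

Lemma pou_integral_lin w w' (c : R) :
  continuous_coef w -> continuous_coef w' ->
  pou_integral P (fun i x => w i x + c * w' i x) =
  pou_integral P w + c * pou_integral P w'.
Proof.
move=> cw cw'; rewrite /pou_integral mulr_sumr -big_split/=.
apply: eq_bigr => k _; have [r r0 sr] := pou_radius k.
rewrite -(int_rV_lin r0 c (sr w cw) (sr w' cw')); congr int_rV.
by apply/funext => y; rewrite /pou_term; ring.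
Qed.

Lemma pou_integralZ w (c : R) : continuous_coef w ->
  pou_integral P (fun i x => c * w i x) = c * pou_integral P w.
Proof.
move=> cw; (* [c w = w + (c - 1) w] *)
have := pou_integral_lin (c - 1) cw cw.
rewrite mulrBl mul1r [X in _ = X]addrC subrK => <-; congr (pou_integral P _).
by apply/funext => i; apply/funext => x; ring.
Qed.

(** Each integrand is supported in a fixed compact set, on which joint
    convergence is uniform, and the functions of the partition are bounded by 1.
    *)
Lemma pou_integral_cvg {X : Type} (G : set_system X) {FG : Filter G}
    (w : X -> ix -> M -> R) (w0 : ix -> M -> R) :
  (\forall t \near G, continuous_coef (w t)) -> continuous_coef w0 ->
  (forall i y, img i y -> w p.1 i (psi i p.2) @[p --> filter_prod G (nbhs y)]
      --> w0 i (psi i y)) ->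
  pou_integral P (w t) @[t --> G] --> pou_integral P w0.
Proof.
move=> cw cw0 ww0; apply: (cvg_big (op := +%R) (@add_continuous R)) => k _.
have [r r0 sr] := pou_radius k.
apply: (int_rV_cvg r0) => [||e e0]; [|exact: sr|].
  by apply: filterS cw => t; exact: sr.
have [cK Ki K0] := pou_compactP k; set i := pou_ix k in Ki.
have e20 : 0 < e / 2 by rewrite divr_gt0.
have H : \forall t \near G, forall y, pou_compact k y ->
    `|w0 i (psi i y) - w t i (psi i y)| <= e.
  apply: (@near_compact _ G _ _ _
    (fun t y => `|w0 i (psi i y) - w t i (psi i y)| <= e)) => // y Ky.
  have yi := Ki _ Ky.
  have /cvgrPdist_lt /(_ _ e20) H1 := ww0 i y yi.
  have /cvgrPdist_lt /(_ _ e20) H2 := cw0 i y yi.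
  near=> p; rewrite -(subrKA (w0 i (psi i y))) [e]splitr.
  apply: le_trans (ler_normD _ _) _; apply: lerD; apply: ltW; last by near: p.
  by rewrite distrC; near: p; exact: (@filter_prod2 _ _ G (nbhs y) _ _ H2).
apply: filterS H => t Ht y.
have [Ky|Ky] := pselect (pou_compact k y); last first.
  by rewrite ![_ * _](K0 _ _ Ky) subrr normr0 ltW.
rewrite -!mulrBr !normrM; apply: le_trans (Ht y Ky).
rewrite mulrA ler_piMl// mulr_ile1//.
  by rewrite indicE; case: (_ \in _); rewrite ?normr1 ?normr0.
by rewrite ger0_norm ?pou_ge0// pou_le1.
Unshelve. all: by end_near. Qed.

(** All the terms of the integral are nonnegative, hence vanish, and some
    function of the partition is nonzero at [x]. *)
Lemma pou_integral_eq0 w : continuous_coef w ->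
  (forall i x, dom i x -> 0 <= w i x) -> pou_integral P w = 0 ->
  forall x, exists2 i, dom i x & w i x = 0.
Proof.
move=> cw w0 I0 x.
have t0 (k : 'I_(pou_size P)) y : 0 <= pou_term k w y.
  rewrite /pou_term indicE.
  case: (boolP (y \in _)) => [/set_mem yi|_]; last by rewrite mul0r.
  by rewrite mul1r mulr_ge0 ?pou_ge0// w0//; have [] := psiK yi.
have int0 (k : 'I_(pou_size P)) : 0 <= int_rV (@pou_term P k w).
  by have [r r0 sr] := pou_radius k; exact: (int_rV_ge0 r0 (sr w cw) (t0 k)).
have [k kx] : exists k : 'I_(pou_size P), pou_fun k x != 0.
  apply: contrapT => H; have := pou_sum P x; rewrite big1 => [/eqP|k _].
    by rewrite eq_sym oner_eq0.
  by apply/eqP; apply: contrapT => /negP nz; apply: H; exists k.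
have xi : dom (pou_ix k) x.
  by apply: (@pou_support _ _ _ P k); exact: subset_closure.
exists (pou_ix k) => //; have [r r0 sr] := pou_radius k.
have Ik : int_rV (pou_term k w) = 0.
  have /psumr_eq0P := I0; apply=> // j _; exact: int0.
have := int_rV_eq0 r0 (sr w cw) (t0 k) Ik (phi (pou_ix k) x).
rewrite /pou_term indicE mem_set; last by exists x.
by rewrite mul1r phiK// => /eqP; rewrite mulf_eq0 (negPf kx)/= => /eqP.
Qed.

End PouIntegral.
End ManifoldIntegral.

(** * The Fisher-Rao metric *)

Section PowerQuotient.
Context {R : realType}.

Lemma powR_continuous_base (p x : R) : 0 < x ->
  {for x, continuous (fun y : R => y `^ p)}.
Proof.
move=> x0; have [d _] := is_derive1_powR p x0.
by apply: differentiable_continuous; exact/derivable1_diffP.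
Qed.

Lemma has_dderive_powR (p x v : R) : 0 < x ->
  has_dderive (fun y : R^o => y `^ p : R^o) (x : R^o) (v : R^o)
    (v * (p * x `^ (p - 1)) : R^o).
Proof.
move=> x0; have [d dE] := is_derive1_powR p x0.
have D1 : has_dderive (fun y : R^o => y `^ p : R^o) (x : R^o) (1 : R^o)
    (p * x `^ (p - 1) : R^o).
  rewrite -dE; apply: cvg_trans d; apply: near_eq_cvg; near=> h => /=.
  by rewrite /shift /= [h *: 1 + x]addrC.
have := has_dderiveZ (ev_regular (R := R)) (c := v) D1.
by rewrite [v *: (1 : R^o)]mulr1.
Unshelve. all: by end_near. Qed.

Lemma powR_smooth1 (p : R) :
  smooth_upto 1 [set x : R^o | 0 < x] (fun y : R^o => y `^ p : R^o).
Proof.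
split; first by move=> x /= x0; exact: powR_continuous_base.
split; first by move=> x v /= x0; eexists; exact: has_dderive_powR.
split=> // -[x v] /= [x0 _]; rewrite /prop_for /continuous_at /=.
rewrite (dderive_eq ev_regular (@has_dderive_powR p x v x0)).
have c1 : fst @ nbhs ((x, v) : R^o * R^o) --> x by exact: cvg_fst.
have c2 : snd @ nbhs ((x, v) : R^o * R^o) --> v by exact: cvg_snd.
have cp := cvg_comp _ _ c1 (@powR_continuous_base (p - 1) x x0).
apply: cvg_trans
  (cvgM c2 (cvgM (@cvg_cst _ p _ (nbhs ((x, v) : R^o * R^o)) _) cp)).
apply: near_eq_cvg.
have x0' : nbhs (x : R) [set y | 0 < y].
  exact: (open_nbhs_nbhs (conj (@open_gt R 0) x0)).
have q0 : \forall q \near nbhs ((x, v) : R^o * R^o), 0 < q.1 := c1 _ x0'.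
near=> q; rewrite /= (dderive_eq ev_regular (@has_dderive_powR p q.1 q.2 _))//.
by near: q.
Unshelve. all: by end_near. Qed.

(** This is [strong_derivative] on the real line; the moving base point and
    direction will depend on a point of the manifold. *)
Lemma powR_diff_quotient {X : Type} (G : set_system X) {FG : Filter G}
    (p : R) (u w h : X -> R) (u0 w0 : R) :
  0 < u0 -> u @ G --> u0 -> w @ G --> w0 -> h @ G --> 0 ->
  (\forall t \near G, h t != 0) ->
  (h t)^-1 * ((u t + h t * w t) `^ p - u t `^ p) @[t --> G] -->
    w0 * (p * u0 `^ (p - 1)).
Proof.
move=> u00 cu cw ch h0.
rewrite -(dderive_eq ev_regular (@has_dderive_powR p u0 w0 u00)).
exact: (strong_derivative (E := R^o) (F := R^o) ev_regular ev_regular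
  (@open_gt R 0) (@powR_smooth1 p) u00 cu cw ch h0).
Qed.

End PowerQuotient.

Section FisherRao.
Context {R : realType} {n : nat} (M : closed_oriented_manifold R n).
Variables (alpha : R) (lambda : nform M) (lambda_pos : dens_pos M lambda).
Local Notation E := (nform M : preTopologicalLmodType R).
Local Notation p := (- alpha - 1).
Implicit Types mu a b c : nform M.

Definition fr_coef mu a b (i : chart_ix M) (x : M) : R :=
  radon_nikodym mu lambda x `^ p * radon_nikodym a lambda x *
  radon_nikodym b lambda x * lambda i x.

Lemma fr_coefE mu a b i x : dom i x ->
  fr_coef mu a b i x =
  (mu i x / lambda i x) `^ p * (a i x * b i x / lambda i x).
Proof.
move=> xi; rewrite /fr_coef !(radon_nikodymE _ lambda_pos xi).
by field; exact: dens_pos_neq0.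
Qed.

Lemma chart_rep_cvg {X : Type} (G : set_system X) {FG : Filter G}
    (u : X -> nform M) (w : nform M) i y : img i y -> u @ G --> w ->
  chart_rep (u t.1) i t.2 @[t --> filter_prod G (nbhs y)] --> chart_rep w i y.
Proof.
move=> yi cu A yA.
have [[P Q] /= [GP yQ] PQ] :=
  (ev_cvgP (ev_form M) _ _).1 cu (i, [::], y) yi A yA.
exists (P, pair (i, [::]) @^-1` Q) => //= -[t z] /= [Pt Qz].
exact: (PQ (t, (i, [::], z))).
Qed.

Lemma chart_rep_continuous (w : nform M) i y : img i y ->
  {for y, continuous (chart_rep w i)}.
Proof. by move=> yi; have [] := @chart_rep_smooth _ _ _ w i [::] y yi. Qed.

Lemma fr_coef_continuous mu a b : dens_pos M mu ->
  continuous_coef (fr_coef mu a b).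
Proof.
move=> mu0 i y yi; have [_ xi] := psiK yi.
have l0 : chart_rep lambda i y != 0 by exact: dens_pos_neq0.
have u0 : 0 < chart_rep mu i y / chart_rep lambda i y.
  by rewrite divr_gt0//; [exact: mu0|exact: lambda_pos].
have E : \near y, (chart_rep mu i y / chart_rep lambda i y) `^ p *
    (chart_rep a i y * chart_rep b i y / chart_rep lambda i y) =
    fr_coef mu a b i (psi i y).
  apply: filterS (open_nbhs_nbhs (conj (@open_img _ _ M i) yi)) => z zi.
  by rewrite fr_coefE//; exact: (psiK zi).2.
rewrite /prop_for /continuous_at -(nbhs_singleton E).
apply: cvg_trans (@near_eq_cvg _ _ (nbhs y) _ _ _ E) _.
have cm := chart_rep_continuous (w := mu) yi.
have cl := chart_rep_continuous (w := lambda) yi.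
have ca := chart_rep_continuous (w := a) yi.
have cb := chart_rep_continuous (w := b) yi.
apply: cvgM; last exact: (cvgM (cvgM ca cb) (cvgV l0 cl)).
exact: (cvg_comp _ _ (cvgM cm (cvgV l0 cl)) (@powR_continuous_base R p _ u0)).
Qed.

Lemma fisher_rao_sym mu a b :
  fisher_rao alpha lambda mu a b = fisher_rao alpha lambda mu b a.
Proof.
rewrite /fisher_rao; congr mfd_integral; apply/funext => i; apply/funext => x.
by ring.
Qed.

Lemma fisher_rao_subl mu a b c : dens_pos M mu ->
  fisher_rao alpha lambda mu (a - b) c =
  fisher_rao alpha lambda mu a c - fisher_rao alpha lambda mu b c.
Proof.
move=> mu0; rewrite -[in RHS]mulN1r.
rewrite -[RHS](pou_integral_lin _ (-1) (@fr_coef_continuous mu a c mu0)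
  (@fr_coef_continuous mu b c mu0)).
congr pou_integral; apply/funext => i; apply/funext => x.
have rnB : radon_nikodym (a - b) lambda x =
    radon_nikodym a lambda x - radon_nikodym b lambda x.
  by rewrite -mulrBl.
by rewrite rnB /fr_coef; ring.
Qed.

Lemma fisher_rao_definite mu a : dens_pos M mu ->
  fisher_rao alpha lambda mu a a = 0 -> a = 0.
Proof.
move=> mu0 I0; apply: form_eq => i x xi.
have F0 j z : dom j z -> 0 <= fr_coef mu a a j z.
  move=> zj; rewrite fr_coefE// mulr_ge0 ?powR_ge0//.
  by rewrite -expr2 divr_ge0 ?sqr_ge0// ltW// lambda_pos.
have [j xj] := pou_integral_eq0 (@fr_coef_continuous mu a a mu0) F0 I0 x.
rewrite fr_coefE// => /eqP; rewrite mulf_eq0 gt_eqF/=; last first.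
  by rewrite powR_gt0// divr_gt0//; [exact: mu0|exact: lambda_pos].
rewrite -expr2 mulf_eq0 invr_eq0 (negPf (dens_pos_neq0 lambda_pos xj)) orbF.
rewrite sqrf_eq0 => /eqP aj.
by rewrite (form_change a xi xj) aj mul0r.
Qed.

(** Let [T(a, b, c) = g (D(a, b)) c], with [D] the difference of the
    connections. It is symmetric in [a, b] since both are torsion-free and skew
    in [b, c] since both are metric, so that [T(a,b,c) = - T(a,c,b) = T(c,b,a) =
    - T(a,b,c)]. *)
Lemma levi_civita_unique nabla nabla' :
  levi_civita (fisher_rao alpha lambda) nabla ->
  levi_civita (fisher_rao alpha lambda) nabla' ->
  forall a b : nform M -> nform M, vector_field a -> vector_field b ->
  forall mu, dens_pos M mu -> nabla a b mu = nabla' a b mu.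
Proof.
move=> [_ tor met] [_ tor' met'] a b va vb mu mu0.
pose D (x y : nform M -> nform M) : nform M := nabla x y mu - nabla' x y mu.
pose g (x y : nform M) := fisher_rao alpha lambda mu x y.
have gsym x y : g x y = g y x by exact: fisher_rao_sym.
have Dsym x y : vector_field x -> vector_field y -> D x y = D y x.
  move=> vx vy; have TT : nabla x y mu - nabla y x mu =
      nabla' x y mu - nabla' y x mu by rewrite tor// tor'.
  move/eqP: TT; rewrite /D subr_eq => /eqP ->.
  by rewrite addrAC [X in X + _]addrAC subrr sub0r addrC.
have skew x y z : vector_field x -> vector_field y -> vector_field z ->
    g (D x y) (z mu) = - g (D x z) (y mu).
  move=> vx vy vz.
  have H : g (nabla x y mu) (z mu) + g (y mu) (nabla x z mu) =
      g (nabla' x y mu) (z mu) + g (y mu) (nabla' x z mu) :> R.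
    exact: (ev_cvg_unique ev_regular (met x y z vx vy vz mu mu0)
      (met' x y z vx vy vz mu mu0)).
  rewrite /D /g !fisher_rao_subl// -/(g _ _) -/(g _ _).
  move: H; rewrite !(gsym (y mu)) /g; lra.
have T0 z : vector_field z -> g (D a b) (z mu) = 0.
  move=> vz.
  (* The skew symmetries are applied along the cycle of the three fields. *)
  have e1 := skew a b z va vb vz.
  have e2 := skew z a b vz va vb.
  have e3 := skew b z a vb vz va.
  rewrite (Dsym z a vz va) in e2.
  rewrite (Dsym b z vb vz) (Dsym b a vb va) in e3.
  lra.
apply/eqP; rewrite -subr_eq0; apply/eqP; apply: (fisher_rao_definite mu0).
apply: (T0 (fun=> D a b)) => k.
exact: (smooth_upto_cst k (ev_form M) (ev_form M) _ (@open_dens_pos _ _ M)).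
Qed.

End FisherRao.

(** * The alpha-connection *)

Section AlphaConnection.
Context {R : realType} {n : nat} (M : closed_oriented_manifold R n).
Variables (alpha : R).
Local Notation E := (nform M : preTopologicalLmodType R).
Local Notation k := ((1 + alpha) / 2).
Implicit Types a b c : nform M -> nform M.

Definition alpha_conn a b : nform M -> nform M := fun mu =>
  - k *: form_quot mu (a mu) (b mu) + dderive b mu (a mu).

Section QuotAlgebra.
Variables (mu : nform M) (mu0 : dens_pos M mu).
Implicit Types u v w : nform M.

Lemma form_quotC u v : form_quot mu u v = form_quot mu v u.
Proof.
apply: form_eq => i x xi; apply: etrans (form_quotE u v i x mu0) _.
by rewrite (mulrC (u i x)); exact/esym/form_quotE.
Qed.

Lemma form_quotDl u v w :
  form_quot mu (u + v) w = form_quot mu u w + form_quot mu v w.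
Proof.
apply: form_eq => i x xi; apply: etrans (form_quotE _ _ i x mu0) _.
change ((u i x + v i x) * w i x / mu i x =
  form_quot mu u w i x + form_quot mu v w i x).
by rewrite !mulrDl; congr (_ + _); exact/esym/form_quotE.
Qed.

Lemma form_quotDr u v w :
  form_quot mu w (u + v) = form_quot mu w u + form_quot mu w v.
Proof. by rewrite form_quotC form_quotDl !(form_quotC w). Qed.

Lemma form_quotZl (t : R) u v : form_quot mu (t *: u) v = t *: form_quot mu u v.
Proof.
apply: form_eq => i x xi; apply: etrans (form_quotE _ _ i x mu0) _.
change (t * u i x * v i x / mu i x = t * form_quot mu u v i x).
by rewrite -!mulrA; congr (_ * _); rewrite mulrA; exact/esym/form_quotE.
Qed.

Lemma form_quotZr (t : R) u v : form_quot mu v (t *: u) = t *: form_quot mu v u.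
Proof. by rewrite form_quotC form_quotZl form_quotC. Qed.

End QuotAlgebra.

Let e := ev_form M.
Let oD := @open_dens_pos _ _ M.

Lemma vf_has_dderive b mu (v : nform M) : vector_field b -> dens_pos M mu ->
  has_dderive b mu v (dderive b mu v).
Proof.
move=> vb mu0; apply: has_dderive_dderive.
by have [_ [ex _]] := vb 1; exact: ex.
Qed.

Lemma smooth_line {F : preTopologicalLmodType R} (f : nform M -> F) mu
    (v : nform M) : smooth_on (dens_pos M) f -> dens_pos M mu ->
  f (mu + h *: v) @[h --> (0 : R)^'] --> f mu.
Proof.
move=> sf mu0; have [cf _] := sf 0.
exact: (cvg_comp _ _ (@cvg_line _ _ e mu v) (cf mu mu0)).
Qed.

Lemma alpha_conn_smooth a b : vector_field a -> vector_field b ->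
  vector_field (alpha_conn a b).
Proof.
move=> va vb m.
have sid := smooth_upto_id (U := dens_pos M) m e oD.
have spair := smooth_upto_pair e e e oD sid (va m).
apply: (smooth_upto_linear_comb e e (- k) oD).
  apply: (smooth_upto_comp e (ev_prod e (ev_prod e e)) e oD
    (@open_quot_dom _ _ M) _ (smooth_upto_quot3 M m)
    (smooth_upto_pair e e (ev_prod e e) oD sid
      (smooth_upto_pair e e e oD (va m) (vb m)))).
  by [].
have [_ [_ sdb]] := vb m.+1.
by apply: (smooth_upto_comp e (ev_prod e e) e oD (open_cylinder oD) _ sdb
  spair).
Qed.

Lemma alpha_conn_affine : affine_connection alpha_conn.
Proof.
split.
- exact: alpha_conn_smooth.
- move=> a a' b b' va va' vb vb' aa' bb' mu mu0.
  rewrite /alpha_conn aa'// bb'//.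
  by rewrite (dderive_ext e _ oD bb').
- move=> a a' b va va' vb mu mu0; rewrite /alpha_conn.
  rewrite form_quotDl// (dderiveD e e _ _ oD (vb 1) mu0) scalerDr.
  by rewrite addrACA.
- move=> a b b' va vb vb' mu mu0; rewrite /alpha_conn form_quotDr// scalerDr.
  rewrite addrACA; congr (_ + _); apply: (dderive_eq e).
  rewrite /has_dderive.
  apply: cvg_trans (ev_cvgD e (@vf_has_dderive b mu (a mu) vb mu0)
    (@vf_has_dderive b' mu (a mu) vb' mu0)).
  by apply: near_eq_cvg; near=> h; rewrite -scalerDr opprD addrACA.
- move=> f a b sf va vb mu mu0; rewrite /alpha_conn form_quotZl//.
  by rewrite (dderiveZ e _ _ (vb 1) mu0) scalerDr !scalerA mulrC.
- move=> f a b sf va vb mu mu0; rewrite /alpha_conn form_quotZr//.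
  rewrite scalerDr addrCA scalerA mulrC -scalerA; congr (_ + _).
  apply: (dderive_eq e); rewrite /has_dderive.
  have [_ [exf _]] := sf 1; have df := has_dderive_dderive (exf mu (a mu) mu0).
  have cfmu : (fun=> f mu) @ (0 : R)^' --> (f mu : R) by exact: cvg_cst.
  apply: cvg_trans (ev_cvgD e (ev_cvgZ e df (@smooth_line _ b mu (a mu) vb mu0))
    (ev_cvgZ e cfmu (@vf_has_dderive b mu (a mu) vb mu0))).
  apply: near_eq_cvg; near=> h.
  transitivity (h^-1 *: ((f (mu + h *: a mu) - f mu) *: b (mu + h *: a mu)
      + f mu *: (b (mu + h *: a mu) - b mu))).
    rewrite [RHS]scalerDr; congr (_ + _); first by rewrite scalerA.
    by rewrite !scalerA; congr (_ *: _); exact: mulrC.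
  by rewrite scalerBl scalerBr addrA subrK.
Unshelve. all: by end_near. Qed.

Lemma alpha_conn_torsion_free : torsion_free alpha_conn.
Proof.
move=> a b va vb mu mu0.
rewrite /alpha_conn [form_quot mu (b mu) _]form_quotC//.
by rewrite opprD addrACA subrr add0r.
Qed.

Section Compatibility.
Variables (lambda : nform M) (lambda_pos : dens_pos M lambda).
Local Notation p := (- alpha - 1).

(** Differentiation under the integral sign reduces the statement to a pointwise
    one, in a chart: the difference quotient of the integrand converges, jointly
    in the step and the point, to the integrand of the right-hand side. The
    power of [mu / lambda] and the two fields are differentiated in turn, by
    telescoping. *)
Lemma alpha_conn_metric :
  metric_compatible (fisher_rao alpha lambda) alpha_conn.
Proof.
move=> a b c va vb vc mu mu0.
set A := a mu; set B := b mu; set C := c mu.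
set B' := alpha_conn a b mu; set C' := alpha_conn a c mu.
pose m h : nform M := mu + h *: A.
pose F h := fr_coef alpha lambda (m h) (b (m h)) (c (m h)).
pose F0 := fr_coef alpha lambda mu B C.
pose W i x := fr_coef alpha lambda mu B' C i x
  + 1 * fr_coef alpha lambda mu B C' i x.
(* [Q h] is the difference quotient of the integrand and [W] its limit. *)
pose Q h i x := h^-1 * (F h i x + (-1) * F0 i x).
have cF0 : continuous_coef F0 by exact: fr_coef_continuous.
have cW : continuous_coef W.
  by apply: continuous_coef_lin; exact: fr_coef_continuous.
have mpos : \forall h \near (0 : R)^', dens_pos M (m h).
  exact: (@cvg_line _ _ e mu A _ (open_nbhs_nbhs (conj oD mu0))).
have cF : \forall h \near (0 : R)^', continuous_coef (F h).
  by apply: filterS mpos => h mh; exact: fr_coef_continuous.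
have cQ : \forall h \near (0 : R)^', continuous_coef (Q h).
  apply: filterS cF => h ch i y yi.
  have H := continuous_coef_lin (c := -1) ch cF0 yi.
  apply: (cvgM (@cvg_cst _ h^-1 _ (nbhs y) _) H).
set P := sval (cid (partition_of_unity_exists M)).
rewrite /has_dderive; set L := (X in _ --> X).
have LE : L = pou_integral P W.
  rewrite [RHS](pou_integral_lin P 1 (w := fr_coef alpha lambda mu B' C)
    (w' := fr_coef alpha lambda mu B C')); last 2 first.
  - exact: fr_coef_continuous.
  - exact: fr_coef_continuous.
  by rewrite mul1r.
rewrite LE.
apply: (@cvg_trans _ (pou_integral P (Q h) @[h --> (0 : R)^'])).
  apply: near_eq_cvg; near=> h.
  have ch : continuous_coef (F h) by near: h.
  rewrite pou_integralZ; last exact: continuous_coef_lin.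
  by rewrite pou_integral_lin// mulN1r.
apply: pou_integral_cvg => // i y yi.
pose G := filter_prod (0 : R)^' (nbhs y).
have FG : Filter G by exact: filter_prod_filter.
have [phiy domy] := psiK yi.
have cst (w : nform M) : chart_rep w i t.2 @[t --> G] --> chart_rep w i y.
  by apply: (chart_rep_cvg (u := fun=> w)) => //; exact: cvg_cst.
pose l := chart_rep lambda i; pose l0 := chart_rep lambda i y.
have l00 : l0 != 0 by exact: dens_pos_neq0.
have m00 : chart_rep mu i y != 0 by exact: dens_pos_neq0.
pose u (t : R * 'rV[R]_n) := chart_rep mu i t.2 / l t.2.
pose v (t : R * 'rV[R]_n) := chart_rep A i t.2 / l t.2.
have cl : (l t.2)^-1 @[t --> G] --> l0^-1 by apply: cvgV => //; exact: cst.
have cu : u t @[t --> G] --> chart_rep mu i y / l0.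
  by apply: cvgM => //; exact: cst.
have cv : v t @[t --> G] --> chart_rep A i y / l0.
  by apply: cvgM => //; exact: cst.
have u0 : 0 < chart_rep mu i y / l0.
  by rewrite divr_gt0//; [exact: mu0|exact: lambda_pos].
have ch : t.1 @[t --> G] --> (0 : R).
  by apply: (cvg_trans (@cvg_fst _ _ (0 : R)^' (nbhs y) _)); exact: nbhs_dnbhs.
have h0 : \forall t \near G, t.1 != 0.
  exact: (@filter_prod1 _ _ (0 : R)^' (nbhs y) _ _ (nbhs_dnbhs_neq (0 : R))).
have cpow := powR_diff_quotient (FG := FG) (p := p) u0 cu cv ch h0.
have cup : u t `^ p @[t --> G] --> (chart_rep mu i y / l0) `^ p.
  exact: (cvg_comp _ _ cu (@powR_continuous_base R p _ u0)).
have cB : chart_rep (b (m t.1)) i t.2 @[t --> G] --> chart_rep B i y.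
  exact: (chart_rep_cvg (u := fun h => b (m h)) yi
    (@smooth_line _ b mu A vb mu0)).
have cC : chart_rep (c (m t.1)) i t.2 @[t --> G] --> chart_rep C i y.
  exact: (chart_rep_cvg (u := fun h => c (m h)) yi
    (@smooth_line _ c mu A vc mu0)).
have cdB : chart_rep (t.1^-1 *: (b (m t.1) - B)) i t.2 @[t --> G] -->
    chart_rep (dderive b mu A) i y.
  exact: (chart_rep_cvg (u := fun h => h^-1 *: (b (m h) - B)) yi
    (@vf_has_dderive b mu A vb mu0)).
have cdC : chart_rep (t.1^-1 *: (c (m t.1) - C)) i t.2 @[t --> G] -->
    chart_rep (dderive c mu A) i y.
  exact: (chart_rep_cvg (u := fun h => h^-1 *: (c (m h) - C)) yi
    (@vf_has_dderive c mu A vc mu0)).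
have CM (f g : R * 'rV[R]_n -> R) (f0 g0 : R) : f @ G --> f0 -> g @ G --> g0 ->
    (fun t => f t * g t) @ G --> f0 * g0 by move=> cf cg; exact: (cvgM cf cg).
have CD (f g : R * 'rV[R]_n -> R) (f0 g0 : R) : f @ G --> f0 -> g @ G --> g0 ->
    (fun t => f t + g t) @ G --> f0 + g0 by move=> cf cg; exact: (cvgD cf cg).
have lim := CD _ _ _ _ (CM _ _ _ _ cpow (CM _ _ _ _ (CM _ _ _ _ cB cC) cl))
  (CD _ _ _ _ (CM _ _ _ _ cup (CM _ _ _ _ (CM _ _ _ _ cdB cC) cl))
     (CM _ _ _ _ cup (CM _ _ _ _ (CM _ _ _ _ (cst B) cdC) cl))).
set L0 := (X in _ --> X) in lim.
have -> : W i (psi i y) = L0.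
  rewrite /W !fr_coefE// -[mu i _]/(chart_rep mu i y) -[lambda i _]/l0.
  have B'E : B' i (psi i y) =
      - k * (chart_rep A i y * chart_rep B i y / chart_rep mu i y)
      + chart_rep (dderive b mu A) i y.
    by rewrite -[chart_rep A i y * _ / _](form_quotE A B i (psi i y) mu0).
  have C'E : C' i (psi i y) =
      - k * (chart_rep A i y * chart_rep C i y / chart_rep mu i y)
      + chart_rep (dderive c mu A) i y.
    by rewrite -[chart_rep A i y * _ / _](form_quotE A C i (psi i y) mu0).
  rewrite B'E C'E -[B i _]/(chart_rep B i y) -[C i _]/(chart_rep C i y) /L0.
  (* The derivative of the power has to be compared with the power itself:
     [u `^ (p - 1) = u `^ p / u]. *)
  rewrite (powRB (r := p) (s := 1)); last by apply/implyP => _; rewrite gt_eqF.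
  rewrite powRr1; last exact: ltW.
  by field; rewrite l00 m00.
apply: cvg_trans lim; apply: near_eq_cvg.
have mG : \forall t \near G, dens_pos M (m t.1).
  exact: (@filter_prod1 _ _ (0 : R)^' (nbhs y) _ _ mpos).
have iG : \forall t \near G, img i t.2.
  exact: (@filter_prod2 _ _ (0 : R)^' (nbhs y) _ _ 
    (open_nbhs_nbhs (conj (@open_img _ _ M i) yi))).
near=> t.
have mt : dens_pos M (m t.1) by near: t; exact: mG.
have it : img i t.2 by near: t; exact: iG.
have [_ dt] := psiK it.
have uvE : u t + t.1 * v t = chart_rep (m t.1) i t.2 / l t.2.
  by rewrite /u /v mulrA -mulrDl.
rewrite /Q /F /F0 !fr_coefE// uvE.
have dE (w w' : nform M) : chart_rep (t.1^-1 *: (w - w')) i t.2 =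
  t.1^-1 * (chart_rep w i t.2 - chart_rep w' i t.2) by [].
rewrite !dE -[mu i _ / _]/(u t).
rewrite -[m t.1 i _ / _]/(chart_rep (m t.1) i t.2 / l t.2).
rewrite -[b (m t.1) i _]/(chart_rep (b (m t.1)) i t.2).
rewrite -[c (m t.1) i _]/(chart_rep (c (m t.1)) i t.2).
rewrite -[B i _]/(chart_rep B i t.2) -[C i _]/(chart_rep C i t.2).
rewrite -[lambda i _]/(l t.2).
by ring.
Unshelve. all: by end_near. Qed.

End Compatibility.
End AlphaConnection.

Theorem theorem3p3 (R : realType) (n : nat) (M : closed_oriented_manifold R n)
    (alpha : R) (lambda : nform M) (lambda_pos : dens_pos M lambda) :
  (exists nabla, levi_civita (fisher_rao alpha lambda) nabla) /\
  (forall nabla, levi_civita (fisher_rao alpha lambda) nabla ->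
   forall a b : nform M -> nform M, vector_field a -> vector_field b ->
   forall mu : nform M, dens_pos M mu ->
     (forall i x, nabla a b mu i x =
        dderive b mu (a mu) i x -
        (1 + alpha) / 2 * (radon_nikodym (a mu) mu x *
                           radon_nikodym (b mu) mu x * mu i x)) /\
     (forall i x, nabla a b mu i x = amari_cencov alpha a b mu i x)).
Proof.
have LC : levi_civita (fisher_rao alpha lambda) (@alpha_conn R n M alpha).
  split; [exact: alpha_conn_affine|exact: alpha_conn_torsion_free|].
  exact: alpha_conn_metric.
split; first by exists (@alpha_conn R n M alpha).
move=> nabla LCnabla a b va vb mu mu0.
rewrite (levi_civita_unique lambda_pos LCnabla LC va vb mu0).
have E i x : alpha_conn alpha a b mu i x = dderive b mu (a mu) i x -
    (1 + alpha) / 2 * (a mu i x * b mu i x / mu i x).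
  by rewrite -(form_quotE (a mu) (b mu) i x mu0) addrC -mulNr.
split=> i x; rewrite E.
  congr (_ - _ * _); have [xi|xi] := pselect (dom i x); last first.
    by rewrite !(form_coef0 _ xi) !mul0r mulr0.
  rewrite !(radon_nikodymE _ mu0 xi); field; exact: dens_pos_neq0.
rewrite /amari_cencov; congr (_ - _ * _).
have [xi|xi] := pselect (dom i x); last first.
  by rewrite !(form_coef0 _ xi) !mul0r mulr0.
by rewrite (radon_nikodymE _ mu0 xi) mulrAC.
Qed.
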